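(* Fix $q\in(0,1)$ and let $(\Gamma_n)_{n\ge1}$ be a sequence of graphs with a vertex cover $U_n$ such that: (1) the induced subgraph $H_n=\Gamma_n[U_n]$ is edgeless; (2) every vertex $w\in W_n=v(\Gamma_n)\setminus U_n$ has exactly one neighbor in $U_n$. For each $u\in U_n$ define $$d_{W_n}(u)=|\{w\in W_n:\{u,w\}\in e(\Gamma_n)\}|,\quad \Delta_n=\max_{u\in U_n}d_{W_n}(u),\quad S_{2,n}=\sum_{u\in U_n}d_{W_n}^2(u),$$ and let $$\kappa_n=\max_{d\ge1}m_d(\Gamma_n)\,d^2,\qquad m_d(\Gamma_n)=|\{u\in v(\Gamma_n):\deg_{\Gamma_n}(u)\ge d\}| .$$ (i) If $Q_n=o\left(\frac{n^3}{S_{2,n}}\right)$, then weak detection is impossible with query budget $Q_n$. (ii) Conversely, suppose that at a maximizing degree level $d$ in the definition of $\kappa_n$ the following feasibility conditions hold: with $m=\left\lceil C_1\frac{n^2}{d^2}\log n\right\rceil$, where $C_1>0$ is a sufficiently large constant depending only on $q$, $$m\le\frac n2\qquad\text{and}\qquad\frac{|v(\Gamma_n)|\,m}{n}\ge10\log n .$$ Then $Q_n\gtrsim\frac{n^3}{\kappa_n}\log^2n$ implies strong detection with query budget $Q_n$. (iii) Moreover, $$\kappa_n\le S_{2,n}\le4\left(1+\lfloor\log_2\Delta_n\rfloor\right)\kappa_n .$$ Consequently, the lower and upper bounds on the query complexity in (i) and (ii) differ by at most a factor of order $\log\Delta_n\cdot\log^2n$. In particular, if the values $d_{W_n}(u)$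 are all of the same order, then the two bounds match up to a factor of $\log^2n$.
   Context: Setup. $\Gamma_n$ is an undirected graph without isolated vertices, with $|v(\Gamma_n)|\le n$; $\deg_{\Gamma_n}(u)$ is the degree of $u$ in $\Gamma_n$. A vertex cover is a set of vertices meeting every edge. Under $\mathcal H_0$, $G$ is a random graph on $[n]=\{1,\dots,n\}$ in which each pair in $\binom{[n]}{2}$ is an edge independently with probability $q$. Under $\mathcal H_1$, a copy $\Gamma_n^\star$ is drawn uniformly from the set of all subgraphs of the complete graph on $[n]$ isomorphic to $\Gamma_n$; all edges of $\Gamma_n^\star$ are in $G$, and every other pair is an edge independently with probability $q$. For a query set $\mathcal Q\subseteq\binom{[n]}{2}$ (chosen non-adaptively), the transcript is $G_{\mathcal Q}=(\mathbf 1\{e\in e(G)\})_{e\in\mathcal Q}$, with laws $\mathbb P_{\mathcal H_0,\mathcal Q}$ and $\mathbb P_{\mathcal H_1,\mathcal Q}$ under the two hypotheses. The optimal risk under budget $Q_n$ is $R^\star_{n,Q_n}=1-\sup_{|\mathcal Q|\le Q_n}d_{\mathrm{TV}}(\mathbb P_{\mathcal H_1,\mathcal Q},\mathbb P_{\mathcal H_0,\mathcal Q})$. Weak detection is impossible with budget $Q_n$ if $\lim_{n\to\infty}R^\star_{n,Q_n}=1$. Strong detection with budget $Q_n$ means that there are (possibly random) query sets $\mathcal Q_n$ with $|\mathcal Q_n|\le Q_n$ and (possibly randomized) tests based on $G_{\mathcal Q_n}$ whose sum of type-I and type-II error probabilities tends to $0$. Here $Q_n\gtrsim b_n$ means $Q_n\ge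 C\,b_n$ for all large $n$, for a sufficiently large constant $C=C(q)$.
   Formalization: κ_n ≤ S_{2,n} fails (single edge: κ=2, S_2=1); proved instead: κ_n ≤ 2S_{2,n}, κ_n ≤ S_{2,n} iff |v(Γ_n)| ≤ S_{2,n}, and κ_n ≤ S_{2,n} for large n under the feasibility conditions of (ii); log Δ_n is read as max(1, log Δ_n). *)

(* Defs.v *)
From mathcomp Require Import all_boot all_order all_algebra.
From mathcomp Require Import all_classical all_reals all_analysis.

Set Implicit Arguments.
Unset Strict Implicit.
Unset Printing Implicit Defensive.

Import Order.TTheory GRing.Theory Num.Theory.
Import numFieldNormedType.Exports.

Local Open Scope classical_set_scope.
Local Open Scope set_scope.
Local Open Scope ring_scope.

Record sgraph := SGraph {
  vertex :> finType;
  adj : rel vertex;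
  adj_sym : symmetric adj;
  adj_irr : irreflexive adj }.

Definition neighbors (G : sgraph) (u : G) : {set G} := [set w | adj u w].
Definition deg (G : sgraph) (u : G) : nat := #|neighbors u|.
Definition edges (G : sgraph) : {set {set G}} :=
  [set [set p.1; p.2] | p in [set p : G * G | adj p.1 p.2]].

Definition no_isolated (G : sgraph) : Prop :=
  forall u : G, exists w : G, adj u w.
Definition vertex_cover (G : sgraph) (U : {set G}) : Prop :=
  forall u w : G, adj u w -> (u \in U) || (w \in U).
Definition edgeless_on (G : sgraph) (U : {set G}) : Prop :=
  forall u v : G, u \in U -> v \in U -> ~~ adj u v.
Definition unique_cover_neighbor (G : sgraph) (U : {set G}) : Prop :=
  forall w : G, w \in ~: U -> #|neighbors w :&: U| = 1%N.

Definition star_family (Gam : nat -> sgraph) (U : forall n, {set Gam n}) : Prop :=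
  forall n : nat, (1 <= n)%N ->
    [/\ (#|Gam n| <= n)%N, no_isolated (Gam n), vertex_cover (U n),
        edgeless_on (U n) & unique_cover_neighbor (U n)].

Definition dW (G : sgraph) (U : {set G}) (u : G) : nat :=
  #|[set w in ~: U | adj u w]|.
Definition Delta (G : sgraph) (U : {set G}) : nat := (\max_(u in U) dW U u)%N.
Definition S2 (G : sgraph) (U : {set G}) : nat := (\sum_(u in U) dW U u ^ 2)%N.

Definition mdeg (G : sgraph) (d : nat) : nat := #|[set u : G | (d <= deg u)%N]|.
(* Degrees are smaller than #|G|, so the levels d > #|G| contribute 0 and the
   maximum over all d >= 1 is this finite one. *)
Definition kappa (G : sgraph) : nat :=
  (\max_(1 <= d < #|G|.+1) mdeg G d * d ^ 2)%N.
Definition maximizing_level (G : sgraph) (d : nat) : Prop :=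
  (1 <= d)%N /\ (mdeg G d * d ^ 2)%N = kappa G.

(* The vertex set [n] is 'I_n; a set of pairs, in particular a graph on [n],
   is a subset of [pairs n]. *)
Definition pairset (n : nat) : finType := {set {set 'I_n}}.
Definition pairs (n : nat) : pairset n := [set e : {set 'I_n} | #|e| == 2%N].

(* Subgraphs of the complete graph on [n] isomorphic to G, as pairs
   (vertex set, edge set). *)
Definition copies (G : sgraph) (n : nat) : {set {set 'I_n} * pairset n} :=
  [set H : {set 'I_n} * pairset n | [exists f : {ffun G -> 'I_n},
     [&& injectiveb f,
         H.1 == [set f x | x in [set: G]] &
         H.2 == [set [set f x | x in e] | e : {set G} in edges G]]]].

Section Laws.
Variables (R : realType) (q : R) (n : nat).

(* Probability that the random graph is E, when all the pairs in F are edges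
   and the other pairs are edges independently with probability q. *)
Definition forced_law (F E : pairset n) : R :=
  if (F \subset E) && (E \subset pairs n) then
    \prod_(e in pairs n :\: F) (if e \in E then q else 1 - q)
  else 0.

Definition law_H0 (E : pairset n) : R := forced_law finset.set0 E.
Definition law_H1 (G : sgraph) (E : pairset n) : R :=
  #|copies G n|%:R^-1 * \sum_(H in copies G n) forced_law H.2 E.

(* The 0/1 vector (1{e in E})_(e in Q) is encoded by the set E :&: Q of the
   queried pairs that are edges. *)
Definition transcript_law (P : pairset n -> R) (Q x : pairset n) : R :=
  \sum_(E | E :&: Q == x) P E.

Definition dTV (P P' : pairset n -> R) : R :=
  2^-1 * \sum_x `|P x - P' x|.

Definition admissible (b : nat) (Q : pairset n) : bool :=
  (Q \subset pairs n) && (#|Q| <= b)%N.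

(* A supremum over a finite nonempty set of nonnegative values, whence the
   default 0. *)
Definition opt_risk (G : sgraph) (b : nat) : R :=
  1 - \big[Num.max/0]_(Q | admissible b Q)
        dTV (transcript_law (law_H1 G) Q) (transcript_law law_H0 Q).

Definition random_query (b : nat) (mu : pairset n -> R) : Prop :=
  [/\ forall Q, 0 <= mu Q, \sum_Q mu Q = 1 &
      forall Q, mu Q != 0 -> admissible b Q].

(* phi Q x is the probability of deciding for H1 after querying Q and seeing
   the transcript x. *)
Definition random_test (phi : pairset n -> pairset n -> R) : Prop :=
  forall Q x, 0 <= phi Q x <= 1.

Definition type_I (mu : pairset n -> R) (phi : pairset n -> pairset n -> R) : R :=
  \sum_Q mu Q * \sum_x transcript_law law_H0 Q x * phi Q x.
Definition type_II (G : sgraph) (mu : pairset n -> R)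
    (phi : pairset n -> pairset n -> R) : R :=
  \sum_Q mu Q * \sum_x transcript_law (law_H1 G) Q x * (1 - phi Q x).

End Laws.

Definition weak_detection_impossible (R : realType) (q : R)
    (Gam : nat -> sgraph) (Qn : nat -> nat) : Prop :=
  (fun n => opt_risk q n (Gam n) (Qn n)) @ \oo --> (1 : R).

Definition strong_detection (R : realType) (q : R)
    (Gam : nat -> sgraph) (Qn : nat -> nat) : Prop :=
  exists (mu : forall n, pairset n -> R)
         (phi : forall n, pairset n -> pairset n -> R),
    (forall n, (1 <= n)%N -> random_query (Qn n) (mu n) /\ random_test (phi n)) /\
    (fun n => type_I q (mu n) (phi n) + type_II q (Gam n) (mu n) (phi n))
      @ \oo --> (0 : R).

Section Bounds.
Variable R : realType.

Definition lower_bound (n : nat) (G : sgraph) (U : {set G}) : R :=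
  n%:R ^+ 3 / (S2 U)%:R.
Definition upper_bound (n : nat) (G : sgraph) : R :=
  n%:R ^+ 3 / (kappa G)%:R * ln n%:R ^+ 2.

(* Convergence of the ratio to 0. When S2 = 0 (empty graph) the ratio is 0
   because _ / 0 = 0, which agrees with reading n^3 / 0 as +oo. *)
Definition budget_below (Gam : nat -> sgraph) (U : forall n, {set Gam n})
    (Qn : nat -> nat) : Prop :=
  (fun n => (Qn n)%:R / lower_bound n (U n)) @ \oo --> (0 : R).

Definition budget_above (C : R) (Gam : nat -> sgraph) (Qn : nat -> nat) : Prop :=
  \forall n \near \oo, C * upper_bound n (Gam n) <= (Qn n)%:R.

Definition level_size (C1 : R) (n d : nat) : int :=
  Num.ceil (C1 * (n%:R ^+ 2 / d%:R ^+ 2) * ln n%:R).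

(* For large n only: with C1 large, m <= n/2 fails for small n. *)
Definition feasible (C1 : R) (Gam : nat -> sgraph) : Prop :=
  \forall n \near \oo, exists d : nat,
    [/\ maximizing_level (Gam n) d,
        (level_size C1 n d)%:~R <= n%:R / 2 :> R &
        10 * ln n%:R <= #|Gam n|%:R * (level_size C1 n d)%:~R / n%:R :> R].

End Bounds.

(* Main.v *)
(* The hypotheses make Gamma_n a disjoint union of stars with centers U_n.

   Impossibility. A uniform copy is invariant under permutations of [n]. Place
   the centers first and permute the remaining points A of [n] by a uniform
   permutation of A. By convexity of the total variation it suffices to bound,
   for fixed positions of the centers, the chi-square divergence of the mixture
   over the leaf permutations, that is E q^-|overlap| for two independent leaf
   permutations. Expanding over sets S of potential edges and using
   P(S is planted) <= prod_(S) (e d_u / |A|) gives at most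
   exp((1/q - 1) sum (e d_u / |A|)^2), the sum being over the queried
   center-to-A edges. Its exponent is small for most positions of the centers,
   because its mean is O(Q_n S_2 / n^3). A second moment over all of the copy
   at once would fail: two copies of a large star overlap too much when their
   centers coincide.

   Detection. Let d be the maximizing level and k = m_d. Query all pairs between
   a set A of about (n / k) log n vertices and a set M of m vertices, and accept
   when a vertex of A has an exceptionally large degree into M. Chernoff's bound
   and a union bound control the type I error. Under H_1, Chebyshev's inequality
   shows that A contains a high-degree center, and that every high-degree center
   has at least half of the expected number d m / n of its leaves in M; the
   second union bound costs only a constant because k d <= n. *)

From mathcomp Require Import fingroup perm.
Require Import Defs.
From mathcomp Require Import all_boot all_order all_algebra.
From mathcomp Require Import all_classical all_reals all_analysis.
From mathcomp Require Import fintype finset ring lra zify.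
Import Order.TTheory GRing.Theory Num.Theory.
Import numFieldNormedType.Exports.
Local Open Scope classical_set_scope.
Local Open Scope ring_scope.

Set Implicit Arguments.
Unset Strict Implicit.
Unset Printing Implicit Defensive.

(** * Star forests *)

Section StarForest.
Local Open Scope set_scope.
Variables (G : sgraph) (U : {set G}).
Hypotheses (isoG : no_isolated G) (covU : vertex_cover U) (indU : edgeless_on U)
  (uniqU : unique_cover_neighbor U).

Lemma adj_cover (u w : G) : u \in U -> adj u w -> w \notin U.
Proof. by move=> uU uw; apply/negP => wU; have := indU uU wU; rewrite uw. Qed.

Lemma deg_cover (u : G) : u \in U -> deg u = dW U u.
Proof.
move=> uU; apply: eq_card => w; rewrite !inE.
by case uw: (adj u w); rewrite ?andbF // (adj_cover uU uw).
Qed.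

Lemma deg_leaf (w : G) : w \notin U -> deg w = 1%N.
Proof.
move=> wU; rewrite -(uniqU (w := w)) ?inE //; apply: eq_card => u; rewrite !inE.
by case wu: (adj w u) => //=; have := covU wu; rewrite (negPf wU).
Qed.

Lemma dW_gt0 (u : G) : u \in U -> (0 < dW U u)%N.
Proof.
move=> uU; rewrite -deg_cover //; have [w uw] := isoG u.
by apply/card_gt0P; exists w; rewrite inE.
Qed.

Lemma leaf_center (u v w : G) :
  u \in U -> v \in U -> adj u w -> adj v w -> u = v.
Proof.
move=> uU vU uw vw; have wU := adj_cover uU uw.
have /eqP/cards1P[x nx] := uniqU (w := w) ltac:(by rewrite inE).
have : u \in [set x] by rewrite -nx !inE adj_sym uw.
have : v \in [set x] by rewrite -nx !inE adj_sym vw.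
by rewrite !inE => /eqP -> /eqP ->.
Qed.

(** Double counting of the center-leaf pairs, each leaf having exactly one center. *)
Lemma card_leaves : #|~: U| = (\sum_(u in U) dW U u)%N.
Proof.
rewrite -sum1_card (eq_bigr (fun w => #|neighbors w :&: U|)); last first.
  by move=> w wU; rewrite uniqU.
under eq_bigr => w _ do rewrite -sum1_card.
under [RHS]eq_bigr => u _ do rewrite /dW -sum1_card.
rewrite (exchange_big_dep (mem U)) /=; last by move=> w u _ /setIP[].
apply: eq_bigr => u uU; apply: eq_bigl => w.
by rewrite !inE uU andbT adj_sym.
Qed.

(** Distinct stars share no leaf. Applied to the k vertices of degree at least [d], with [d >= 2],
    this gives [k d <= n], which keeps the union bound over centers affordable in the detection
    part. *)
Lemma sum_deg_cover (B : {set G}) :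
  B \subset U -> (\sum_(u in B) deg u <= #|~: U|)%N.
Proof.
move=> BU; rewrite card_leaves [leqRHS](big_setID B) /=.
have /setIidPr -> := BU; apply: leq_trans (leq_addr _ _).
by apply: leq_sum => u uB; rewrite deg_cover // (subsetP BU).
Qed.

Lemma card_cover_leaves : (#|G| = #|U| + #|~: U|)%N.
Proof. by rewrite cardsC. Qed.

(** Each center owns a leaf because no vertex is isolated. So the centers occupy at most half of the
    points, and the leaf permutation acts on at least n/2 of them. *)
Lemma card_cover_le : (#|U| <= #|~: U|)%N.
Proof.
by rewrite card_leaves -sum1_card; apply: leq_sum => u uU; exact: dW_gt0.
Qed.

Lemma mdeg1 : mdeg G 1 = #|G|.
Proof.
rewrite -cardsT; apply: eq_card => u; rewrite !inE.
have [w uw] := isoG u; apply/card_gt0P; by exists w; rewrite inE.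
Qed.

Lemma deg_lt_card (u : G) : (deg u < #|G|)%N.
Proof.
rewrite -cardsT; apply/proper_card/properP; split; first exact: subsetT.
by exists u; rewrite // inE adj_irr.
Qed.

Lemma kappa_ge (d : nat) : (mdeg G d * d ^ 2 <= kappa G)%N.
Proof.
case: d => [|d]; first by rewrite muln0.
have [dG|dG] := leqP d.+1 #|G|.
  rewrite /kappa (bigD1_seq d.+1) ?iota_uniq ?mem_index_iota ?ltnS //=.
  exact: leq_maxl.
rewrite [mdeg _ _](_ : _ = 0)%N //; apply/eqP; rewrite cards_eq0.
apply/eqP/setP => u; rewrite !inE; apply/negbTE; rewrite -ltnNge.
exact: ltn_trans (deg_lt_card u) dG.
Qed.

Lemma high_deg_cover (d : nat) :
  (2 <= d)%N -> [set u : G | (d <= deg u)%N] \subset U.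
Proof.
move=> d2; apply/subsetP => u; rewrite inE; apply: contraTT => uU.
by rewrite deg_leaf // -ltnNge.
Qed.

(** Level 1 also counts the leaves, which do not enter [S2]; from level 2 on only centers have large
    enough degree. *)
Lemma mdeg_sqr_le (d : nat) : (2 <= d)%N -> (mdeg G d * d ^ 2 <= S2 U)%N.
Proof.
move=> d2; rewrite /mdeg -sum1_card big_distrl /= /S2.
rewrite [leqRHS](big_setID [set u : G | (d <= deg u)%N]) /=.
have /setIidPr -> := high_deg_cover d2; apply: leq_trans (leq_addr _ _).
apply: leq_sum => u; rewrite inE => du.
by rewrite mul1n -deg_cover ?leq_exp2r // (subsetP (high_deg_cover d2)) ?inE.
Qed.

Lemma card_le_2S2 : (#|G| <= 2 * S2 U)%N.
Proof.
have WS : (#|~: U| <= S2 U)%N.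
  by rewrite card_leaves; apply: leq_sum => u uU; rewrite expnS expn1 leq_pmulr ?dW_gt0.
by rewrite card_cover_leaves mul2n -addnn leq_add // (leq_trans card_cover_le).
Qed.

(** Level 1 contributes [#|G|] and every higher level at most [S2 U], so level 1 alone can push
    [kappa] above [S2]. *)
Lemma kappa_le (b : nat) : (#|G| <= b)%N -> (S2 U <= b)%N -> (kappa G <= b)%N.
Proof.
move=> Gb Sb; rewrite /kappa big_nat; elim/big_ind: _ => // [x y|d /andP[d1 _]].
  by rewrite geq_max => -> ->.
case: d d1 => [|[|d]] // _; first by rewrite mdeg1 muln1.
exact: leq_trans (mdeg_sqr_le _) Sb.
Qed.

(** The factor 2 is attained by a perfect matching: level 1 counts both ends of every edge, while
    [S2] counts one. *)
Lemma kappa_le_2S2 : (kappa G <= 2 * S2 U)%N.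
Proof. by apply: kappa_le card_le_2S2 _; rewrite leq_pmull. Qed.

Lemma kappa_le_S2 : (kappa G <= S2 U)%N <-> (#|G| <= S2 U)%N.
Proof.
split=> [|/kappa_le]; last by apply.
by apply: leq_trans; rewrite -mdeg1; apply: leq_trans (kappa_ge 1); rewrite muln1.
Qed.

(* Dyadic decomposition: a center with 2^i <= d < 2^(i+1) contributes at most
   4 * 4^i, and there are at most mdeg 2^i of them. *)
Lemma S2_le : (S2 U <= 4 * (1 + trunc_log 2 (Delta U)) * kappa G)%N.
Proof.
set L := trunc_log 2 (Delta U).
have -> : (4 * (1 + L) * kappa G = \sum_(i < L.+1) 4 * kappa G)%N.
  by rewrite sum_nat_const card_ord; lia.
have /leq_trans -> // : (S2 U <= \sum_(i < L.+1) 4 * (mdeg G (2 ^ i) * (2 ^ i) ^ 2))%N.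
  rewrite /mdeg.
  under eq_bigr => i _ do rewrite -sum1_card big_distrl big_distrr /=.
  have -> : (\sum_(i < L.+1) \sum_(u | u \in [set u : G | 2 ^ i <= deg u]) 4 * (1 * (2 ^ i) ^ 2) =
     \sum_(u : G) \sum_(i < L.+1 | 2 ^ i <= deg u) 4 * (1 * (2 ^ i) ^ 2))%N.
    rewrite (exchange_big_dep predT) //=; apply: eq_bigr => u _.
    by apply: eq_bigl => i; rewrite inE.
  rewrite /S2 [leqRHS](bigID [in U]) /=; apply: leq_trans (leq_addr _ _).
  apply: leq_sum => u uU; have d0 := dW_gt0 uU.
  have iL : (trunc_log 2 (dW U u) < L.+1)%N.
    by rewrite ltnS leq_trunc_log // /Delta (bigD1 u) //= leq_maxl.
  rewrite (bigD1 (Ordinal iL)) /=; last by rewrite deg_cover // trunc_logP.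
  apply: leq_trans (leq_addr _ _).
  have := trunc_log_ltn (dW U u) (isT : (1 < 2)%N); rewrite expnS; nia.
by apply: leq_sum => i _; rewrite leq_mul2l kappa_ge orbT.
Qed.

(** A single level replaces the dyadic decomposition: at the smallest center degree every center is
    counted, and no term of [S2] exceeds c^2 times the square of that degree. *)
Lemma S2_le_regular (c : nat) :
  (forall u v : G, u \in U -> v \in U -> (dW U u <= c * dW U v)%N) ->
  (S2 U <= c ^ 2 * kappa G)%N.
Proof.
move=> reg; have [->|[v vU]] := set_0Vmem U; first by rewrite /S2 big_set0.
have [v0 v0U v0min] := arg_minnP (dW U) vU.
apply: leq_trans (_ : c ^ 2 * (mdeg G (dW U v0) * dW U v0 ^ 2) <= _)%N; last first.
  by rewrite leq_mul2l kappa_ge orbT.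
apply: leq_trans (_ : #|U| * (c * dW U v0) ^ 2 <= _)%N.
  rewrite -sum_nat_const; apply: leq_sum => u uU.
  by rewrite leq_exp2r // reg.
rewrite expnMn mulnCA leq_mul2l leq_mul2r /mdeg subset_leq_card ?orbT //.
by apply/subsetP => u uU; rewrite inE deg_cover ?v0min.
Qed.

End StarForest.

(** * Means and product laws *)

Section Mean.
Local Open Scope set_scope.
Variables (R : realType).

(** Expectation under the uniform law on [A]. It is 0 on the empty set, whence the hypothesis
    [0 <= c] in [mean_le_cst]. *)
Definition mean (I : finType) (A : {set I}) (f : I -> R) : R :=
  #|A|%:R^-1 * \sum_(i in A) f i.

Section OneSet.
Variables (I : finType) (A : {set I}).
Implicit Types f g : I -> R.

Lemma eq_mean f g : {in A, f =1 g} -> mean A f = mean A g.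
Proof. by move=> fg; rewrite /mean (eq_bigr _ fg). Qed.

Lemma mean_le f g : (forall i, i \in A -> f i <= g i) -> mean A f <= mean A g.
Proof. by move=> fg; rewrite ler_wpM2l ?invr_ge0 ?ler0n// ler_sum. Qed.

Lemma mean_ge0 f : (forall i, i \in A -> 0 <= f i) -> 0 <= mean A f.
Proof. by move=> f0; rewrite mulr_ge0 ?invr_ge0 ?ler0n// sumr_ge0. Qed.

Lemma mean_cst c : (0 < #|A|)%N -> mean A (fun=> c) = c.
Proof.
by move=> A0; rewrite /mean sumr_const -(mulr_natl c) mulrA mulVf ?mul1r// pnatr_eq0 -lt0n.
Qed.

Lemma mean_le_cst f c : 0 <= c -> (forall i, i \in A -> f i <= c) -> mean A f <= c.
Proof.
move=> c0 fc; have [/eqP A0|A0] := posnP #|A|.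
  by rewrite cards_eq0 in A0; rewrite /mean (eqP A0) big_set0 mulr0.
by rewrite -[leRHS](mean_cst c A0); exact: mean_le.
Qed.

Lemma mean_sum (J : finType) (P : pred J) (f : I -> J -> R) :
  mean A (fun i => \sum_(j | P j) f i j) = \sum_(j | P j) mean A (f^~ j).
Proof. by rewrite /mean exchange_big /= mulr_sumr. Qed.

Lemma meanZ c f : mean A (fun i => c * f i) = c * mean A f.
Proof. by rewrite /mean -mulr_sumr mulrCA. Qed.

Lemma meanD f g : mean A (fun i => f i + g i) = mean A f + mean A g.
Proof. by rewrite /mean big_split mulrDr. Qed.

Lemma mean_norm f : `|mean A f| <= mean A (fun i => `|f i|).
Proof.
by rewrite /mean normrM ger0_norm ?invr_ge0 ?ler0n// ler_wpM2l ?invr_ge0 ?ler0n// ler_norm_sum.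
Qed.

Lemma mean_mul (J : finType) (B : {set J}) f (g : J -> R) :
  mean A (fun i => mean B (fun j => f i * g j)) = mean A f * mean B g.
Proof.
rewrite mulrC -meanZ; apply: eq_mean => i _.
by rewrite mulrC /mean -mulr_sumr mulrCA.
Qed.

Lemma mean_reindex (h : I -> I) f :
  injective h -> (forall i, (h i \in A) = (i \in A)) -> mean A f = mean A (f \o h).
Proof.
move=> hI hA; rewrite /mean (reindex_inj hI); congr (_ * _).
by apply: eq_bigl => i; rewrite hA.
Qed.

End OneSet.

Lemma mean_exchange (I J : finType) (A : {set I}) (B : {set J}) (f : I -> J -> R) :
  mean A (fun i => mean B (f i)) = mean B (fun j => mean A (f^~ j)).
Proof.
rewrite /mean -mulr_sumr exchange_big /= mulrCA mulr_sumr.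
by rewrite !mulr_sumr.
Qed.

End Mean.

Section ProductLaw.
Local Open Scope set_scope.
Variables (R : realType) (T : finType).
Implicit Types (a b : T -> R) (E Q x : {set T}).

(** Law of the random set that contains each [e] independently with probability [a e]. *)
Definition wt a E : R := \prod_e (if e \in E then a e else 1 - a e).

(** Independence of the coordinates, as an instance of distributivity. Total mass, marginals and
    exponential moments are all read off from it. *)
Lemma wt_expect a (u v : T -> R) :
  \sum_E wt a E * \prod_e (if e \in E then u e else v e) =
  \prod_e (a e * u e + (1 - a e) * v e).
Proof.
rewrite bigA_distr; apply: eq_bigr => E _; rewrite /wt -big_split /=.
by apply: eq_bigr => e _; case: ifP.
Qed.

Lemma wt_sum1 a : \sum_E wt a E = 1.
Proof.
have := wt_expect a (fun=> 1) (fun=> 1).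
rewrite [in RHS]big1; last by move=> e _; rewrite !mulr1 subrKC.
by move<-; apply: eq_bigr => E _; rewrite big1 ?mulr1// => e _; case: ifP.
Qed.

Lemma wt_ge0 a E : (forall e, 0 <= a e <= 1) -> 0 <= wt a E.
Proof.
move=> a01; apply: prodr_ge0 => e _; have /andP[a0 a1] := a01 e.
by case: ifP; rewrite ?subr_ge0.
Qed.

(** Probability 0 outside [Q] makes the law of [E :&: Q] a product law on the same type, so
    transcripts need no type of their own. *)
Definition on Q a (e : T) : R := if e \in Q then a e else 0.

Lemma wt_marginal a Q x : \sum_(E | E :&: Q == x) wt a E = wt (on Q a) x.
Proof.
(* The event [E :&: Q == x] is an intersection of conditions on single coordinates: if [e] is in
   [E], then [e] lies in [Q] exactly when it lies in [x]; otherwise [e] is not in [x]. *)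
have -> : wt (on Q a) x =
    \prod_e (a e * ((e \in Q) == (e \in x))%:R + (1 - a e) * (e \notin x)%:R).
  apply: eq_bigr => e _; rewrite /on; case: (e \in x); case: (e \in Q);
  by rewrite /= ?mulr1 ?mulr0 ?addr0 ?add0r ?subr0 ?subrKC.
rewrite -wt_expect big_mkcond /=; apply: eq_bigr => E _.
case: eqVneq => [<-|ne].
  rewrite big1 ?mulr1// => e _; rewrite inE.
  by case: (e \in E); rewrite /= ?eqxx.
suff /existsP[e ee] : [exists e, (e \in E :&: Q) != (e \in x)].
  rewrite (bigD1 e) //=; move: ee; rewrite inE.
  by case: (e \in E); case: (e \in Q); case: (e \in x) => //=; rewrite mul0r mulr0.
apply: contraNT ne; rewrite negb_exists => /forallP h.
by apply/eqP/setP => e; apply/eqP; have := h e; rewrite negbK.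
Qed.

Lemma wt_pair a b c : \sum_E wt a E * wt b E / wt c E =
  \prod_e (a e * b e / c e + (1 - a e) * (1 - b e) / (1 - c e)).
Proof.
rewrite bigA_distr; apply: eq_bigr => E _; rewrite /wt -prodfV -!big_split /=.
by apply: eq_bigr => e _; case: ifP.
Qed.

End ProductLaw.

(** * Exponential inequalities and Chernoff's bound *)

Section Exponential.
Variable R : realType.

(** Invert [1 - s <= expR (- s)] and use (1 + s + 2 s^2)(1 - s) = 1 + s^2 (1 - 2 s) >= 1. Negative
    [s] is allowed, as the lower tail requires. *)
Lemma expR_le_sqr (s : R) : s <= 2^-1 -> expR s - 1 <= s + 2 * s ^+ 2.
Proof.
move=> s1; have h : 0 < 1 - s by lra.
have h1 : expR s <= (1 - s)^-1.
  by rewrite -[s in expR s]opprK expRN lef_pV2 ?posrE ?expR_gt0// expR_ge1Dx.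
have h2 : (1 - s)^-1 <= 1 + s + 2 * s ^+ 2.
  rewrite -[X in X <= _]mul1r ler_pdivrMr //; nra.
lra.
Qed.

Lemma prod_le_expR (I : finType) (P : pred I) (x : I -> R) :
  (forall i, P i -> 0 <= 1 + x i) ->
  \prod_(i | P i) (1 + x i) <= expR (\sum_(i | P i) x i).
Proof.
by move=> x0; rewrite expR_sum ler_prod// => i Pi; rewrite x0 //= expR_ge1Dx.
Qed.

End Exponential.

Section Tail.
Local Open Scope set_scope.
Variables (R : realType) (T : finType).
Implicit Types (a : T -> R) (A E : {set T}).

(* Chernoff's bound; [s > 0] gives the upper tail and [s < 0] the lower one. *)
Lemma wt_tail a A (s y : R) : (forall e, 0 <= a e <= 1) -> s <= 2^-1 ->
  \sum_(E | s * y <= s * #|E :&: A|%:R) wt a E <=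
  expR (s * (\sum_(e in A) a e - y) + 2 * s ^+ 2 * \sum_(e in A) a e).
Proof.
move=> a01 s1; set mu := \sum_(e in A) a e.
pose u e := if e \in A then expR s else 1.
have key E : \prod_e (if e \in E then u e else 1) = expR (s * #|E :&: A|%:R).
  rewrite -sum1_card natr_sum mulr_sumr expR_sum big_mkcond [RHS]big_mkcond /=.
  apply: eq_bigr => e _; rewrite inE /u mulr1.
  by case: (e \in E); case: (e \in A).
have h1 : \sum_(E | s * y <= s * #|E :&: A|%:R) wt a E <=
    expR (- (s * y)) * \sum_E wt a E * \prod_e (if e \in E then u e else 1).
  rewrite mulr_sumr big_mkcond /=; apply: ler_sum => E _.
  rewrite key; case: ifP => [sy|_]; last first.
    by rewrite !mulr_ge0 ?expR_ge0 ?wt_ge0.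
  by rewrite mulrCA ler_peMr ?wt_ge0// -expRD -[leLHS]expR0 ler_expR addrC subr_ge0.
apply: le_trans h1 _; rewrite wt_expect.
have h2 : \prod_e (a e * u e + (1 - a e) * 1) <= expR (mu * (expR s - 1)).
  have -> : \prod_e (a e * u e + (1 - a e) * 1) = \prod_(e in A) (1 + a e * (expR s - 1)).
    rewrite [RHS]big_mkcond; apply: eq_bigr => e _; rewrite /u.
    by case: ifP => _; ring.
  rewrite mulr_suml; apply: prod_le_expR => e _.
  have /andP[a0 a1] := a01 e; rewrite (_ : _ + _ = (1 - a e) + a e * expR s); last by ring.
  by rewrite addr_ge0 ?subr_ge0// mulr_ge0 ?expR_ge0.
apply: le_trans (ler_wpM2l (expR_ge0 _) h2) _.
rewrite -expRD ler_expR.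
have mu0 : 0 <= mu by apply: sumr_ge0 => e _; have /andP[] := a01 e.
have := expR_le_sqr s1; nra.
Qed.

End Tail.

(** * Uniform permutations *)

Section RandomPerm.
Local Open Scope set_scope.
Variables (R : realType) (T : finType).

Section Hits.
Variables (I : finType) (A : {set T}) (L : I -> {set T}).
Hypotheses (LA : forall i, L i \subset A)
  (Ldisj : forall i j y, y \in L i -> y \in L j -> i = j).

(* [s] is the inverse of the permutation that moves the leaves: [s x \in L i]
   says that the point x receives a leaf of the star i. *)
Definition hits (S : {set I * T}) : {set {perm T}} :=
  [set s in Sym A | [forall p in S, s p.2 \in L p.1]].

Lemma hitsP (S : {set I * T}) (s : {perm T}) :
  reflect (perm_on A s /\ forall p, p \in S -> s p.2 \in L p.1) (s \in hits S).
Proof.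
rewrite !inE; apply: (iffP andP) => -[-> /forall_inP sS]; split=> //; exact/forall_inP.
Qed.

(** The leaf sets are disjoint, so one point cannot receive leaves of two stars: the sites hit
    together have distinct points. *)
Lemma hits_inj (S : {set I * T}) (s : {perm T}) : s \in hits S ->
  {in S &, injective snd}.
Proof.
move=> /hitsP[sA sS] [i x] [j y] /= /sS /= ix /sS /= jy xy; rewrite xy in ix *.
by rewrite (Ldisj ix jy).
Qed.

Lemma hits_size (S : {set I * T}) (s : {perm T}) :
  s \in hits S -> (#|S| <= #|A|)%N.
Proof.
move=> sS; rewrite -(card_in_imset (hits_inj sS)); apply/subset_leq_card.
apply/subsetP => _ /imsetP[p pS ->]; have /hitsP[sA h] := sS.
by rewrite -(perm_closed _ sA) (subsetP (LA p.1)) ?h.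
Qed.

(* Composing a permutation of [hits (p |: S)] with the transposition of p.2 and
   a point z not used by S gives a permutation of [hits S] sending z to L p.1. *)
Lemma hits_step (S : {set I * T}) p : p \notin S ->
  ((#|A| - #|S|) * #|hits (p |: S)| <= #|L p.1| * #|hits S|)%N.
Proof.
move=> pS.
pose D := setX (hits (p |: S)) (A :\: (snd @: S)).
pose h (u : {perm T} * T) := ((tperm p.2 u.2 * u.1)%g, u.2).
have hI : injective h.
  by move=> [s z] [s' z'] [] /[swap] /= -> /mulgI ->.
have hD : h @: D \subset [set u : {perm T} * T | (u.1 \in hits S) && (u.1 u.2 \in L p.1)].
  apply/subsetP => _ /imsetP[[s z] /setXP[/= sp /setDP[zA zS]] ->].
  have /hitsP[sA sh] := sp; rewrite inE /= permM tpermR sh ?setU11 // andbT.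
  apply/hitsP; split.
    apply: perm_onM => //; apply/subsetP => y; rewrite inE.
    apply: contraR => yA; rewrite tpermD //; apply: contraNneq yA => <- //.
    by rewrite -(perm_closed _ sA) (subsetP (LA p.1)) ?sh ?setU11.
  move=> p' p'S; rewrite permM tpermD ?sh ?setU1r //.
    apply: contraNneq pS => pp'.
    by rewrite (hits_inj sp _ _ pp') ?setU11 ?setU1r.
  by apply: contraNneq zS => ->; apply: imset_f.
have cD : ((#|A| - #|S|) * #|hits (p |: S)| <= #|h @: D|)%N.
  rewrite (card_imset _ hI) cardsX mulnC leq_mul2l; apply/orP; right.
  by rewrite cardsD leq_sub2l // (leq_trans (subset_leq_card (subsetIr _ _))) ?leq_imset_card.
apply: leq_trans cD (leq_trans (subset_leq_card hD) _).
rewrite -sum1_card (eq_bigl (fun u => (u.1 \in hits S) && (u.1 u.2 \in L p.1))); last first.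
  by move=> u; rewrite inE.
have -> : (\sum_(u | (u.1 \in hits S) && (u.1 u.2 \in L p.1)) 1 =
    \sum_(s in hits S) \sum_(z | s z \in L p.1) 1)%N by rewrite pair_big_dep.
rewrite mulnC -sum_nat_const leq_eqVlt; apply/orP; left; apply/eqP.
apply: eq_bigr => s _; rewrite sum1_card -(card_preimset (L p.1) (@perm_inj _ s)).
by apply: eq_card => z; rewrite !inE.
Qed.

(** Sites are removed one at a time with [hits_step], and the factors [#|A| - j] accumulate into the
    falling factorial. The product form avoids division when [S] has more than [#|A|] sites. *)
Lemma hits_card (S : {set I * T}) :
  (#|hits S| * #|A| ^_ #|S| <= #|Sym A| * \prod_(p in S) #|L p.1|)%N.
Proof.
have [m] := ubnP #|S|; elim: m S => // m IH S Sm; have [->|[p pS]] := set_0Vmem S.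
  rewrite cards0 big_set0 !muln1; apply/subset_leq_card/subsetP => s.
  by rewrite inE => /andP[].
rewrite (big_setD1 p) //= (cardsD1 p) pS add1n ffactnSr.
have pS' : p \notin S :\ p by rewrite !inE eqxx.
have := hits_step pS'; rewrite setD1K // => h1.
have h2 := IH (S :\ p) ltac:(by move: Sm; rewrite (cardsD1 p) pS).
move: h1 h2; move: (_ - _)%N (_ ^_ _)%N (\prod_(i in _) _)%N => c f P h1 h2.
rewrite [leqRHS]mulnCA; apply: leq_trans (leq_mul (leqnn _) h2).
by rewrite [leqRHS]mulnA [leqLHS]mulnC -[leqLHS]mulnA [leqLHS]mulnC (leq_mul h1).
Qed.

(** Passing from sampling without replacement to independent sampling costs a factor e per draw. The
    induction rests on (1 + 1/N)^k <= e^(k/N) <= e for k <= N. *)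
Lemma expn_le_ffact (N k : nat) : (k <= N)%N ->
  N%:R ^+ k <= expR 1 ^+ k * (N ^_ k)%:R :> R.
Proof.
elim: k N => [|k IH] [|N] //; rewrite ?ffactn0 ?expr0 ?mul1r // ltnS => kN.
rewrite exprS [_ ^+ k.+1]exprS ffactSS natrM.
have h : N.+1%:R ^+ k <= expR 1 * N%:R ^+ k :> R.
  case: N kN => [|N] kN.
    by case: k kN {IH} => // _; rewrite !expr0 mulr1 -[leLHS]expR0 ler_expR ler01.
  have -> : N.+2%:R = (1 + N.+1%:R^-1) * N.+1%:R :> R.
    by rewrite mulrDl mul1r mulVf ?pnatr_eq0// natr1.
  rewrite exprMn ler_wpM2r ?exprn_ge0//.
  apply: le_trans (_ : expR N.+1%:R^-1 ^+ k <= _).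
    by rewrite lerXn2r ?nnegrE ?expR_ge0 ?addr_ge0 ?invr_ge0 ?expR_ge1Dx.
  by rewrite -expRM_natl ler_expR ler_pdivrMr ?ltr0n// mul1r ler_nat.
rewrite [leRHS](_ : _ = N.+1%:R * (expR 1 * (expR 1 ^+ k * (N ^_ k)%:R))); last by ring.
rewrite ler_wpM2l //; apply: le_trans h _.
by rewrite ler_wpM2l ?expR_ge0// IH.
Qed.

Lemma hits_prob (S : {set I * T}) :
  mean (Sym A) (fun s => (s \in hits S)%:R) <=
  \prod_(p in S) (expR 1 * #|L p.1|%:R / #|A|%:R) :> R.
Proof.
have -> : mean (Sym A) (fun s => (s \in hits S)%:R) = #|hits S|%:R / #|Sym A|%:R :> R.
  rewrite /mean mulrC -natr_sum; congr (_%:R / _).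
  rewrite -sum1_card big_mkcond [RHS]big_mkcond; apply: eq_bigr => s _.
  by case: (boolP (s \in hits S)) => [|_]; [rewrite inE => /andP[->]|case: ifP].
have S0 : (0 < #|Sym A|)%N by apply/card_gt0P; exists 1%g; rewrite inE perm_on1.
rewrite ler_pdivrMr ?ltr0n//.
(* If no permutation realizes [S] the probability is 0; otherwise [S] has at most [#|A|] sites and
   [expn_le_ffact] applies. *)
have [->|[s sS]] := set_0Vmem (hits S).
  by rewrite cards0 mulr_ge0 // prodr_ge0 // => p _; rewrite !mulr_ge0 ?invr_ge0 ?expR_ge0.
have SA := hits_size sS.
rewrite big_split big_split /= !prodr_const exprVn.
have NS : (0 < #|A|%:R ^+ #|S| :> R).
  have [->|S1] := posnP #|S|; first by rewrite expr0.
  by rewrite exprn_gt0// ltr0n (leq_trans S1).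
rewrite [leRHS]mulrAC ler_pdivlMr //.
apply: le_trans (ler_wpM2l (ler0n _ _) (expn_le_ffact SA)) _.
rewrite mulrCA -natrM -!mulrA ler_wpM2l ?exprn_ge0 ?expR_ge0//.
by rewrite -natr_prod -natrM ler_nat mulnC [leqRHS]mulnC [leqLHS]mulnC; exact: hits_card.
Qed.

End Hits.

Lemma Sym_setT : Sym [set: T] = setT.
Proof. by apply/setP => s; rewrite !inE; apply/subsetP => x; rewrite inE. Qed.

Local Notation n := (#|T|).
Local Notation unif := (@mean R {perm T} setT).

Lemma unif_cst c : unif (fun=> c) = c.
Proof. by apply: mean_cst; apply/card_gt0P; exists 1%g; rewrite inE. Qed.

(** [hits_card] with singletons as leaf sets: k prescribed values are taken with probability at most
    the inverse of the falling factorial. *)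
Lemma unif_hits (S : {set T * T}) :
  unif (fun s => [forall p in S, s p.2 == p.1]%:R) * (n ^_ #|S|)%:R <= 1.
Proof.
have L1 (i : T) : [set i] \subset [set: T] by exact: subsetT.
have Ld (i j y : T) : y \in [set i] -> y \in [set j] -> i = j by rewrite !inE => /eqP-> /eqP.
have := hits_card L1 Ld S; rewrite Sym_setT !cardsT big1 ?muln1; last first.
  by move=> p _; rewrite cards1.
have -> : unif (fun s => [forall p in S, s p.2 == p.1]%:R) =
    #|hits [set: T] (fun i => [set i]) S|%:R / #|{perm T}|%:R.
  rewrite /mean cardsT mulrC -natr_sum; congr (_%:R / _).
  rewrite -sum1_card big_mkcond [RHS]big_mkcond; apply: eq_bigr => s _.
  rewrite [in RHS]inE Sym_setT !inE /=.
  have -> : [forall p in S, s p.2 \in [set p.1]] = [forall p in S, s p.2 == p.1].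
    by apply: eq_forallb_in => p _; rewrite inE.
  by case: [forall p in S, _].
move=> h; rewrite mulrAC ler_pdivrMr ?ltr0n ?mul1r -?natrM ?ler_nat//.
by apply/card_gt0P; exists 1%g.
Qed.

Lemma unif_single (x b : T) : unif (fun s => (s x == b)%:R) <= n%:R^-1.
Proof.
have n0 : (0 < n)%N by apply/card_gt0P; exists x.
have := unif_hits [set (b, x)]; rewrite cards1 ffactn1 -ler_pdivlMr ?ltr0n// mul1r.
apply: le_trans; apply: mean_le => s _; rewrite ler_nat; case: eqP => // sx.
by rewrite (_ : [forall p in _, _] = true) //; apply/forall_inP => p /set1P ->; apply/eqP.
Qed.

Lemma unif_pair (x y b c : T) : x != y ->
  unif (fun s => ((s x == b) && (s y == c))%:R) <= (n%:R * (n.-1)%:R)^-1.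
Proof.
move=> xy; have [->|bc] := eqVneq b c.
  apply: mean_le_cst => [|s _]; first by rewrite invr_ge0 mulr_ge0.
  case: eqP => [<-|_] /=; rewrite ?(inj_eq perm_inj) 1?eq_sym ?(negPf xy);
  by rewrite invr_ge0 mulr_ge0.
have n1 : (1 < n)%N by apply: leq_trans (max_card [set x; y]); rewrite cards2 xy.
have := unif_hits [set (b, x); (c, y)]; rewrite cards2 xpair_eqE (negPf bc) /=.
rewrite ffactnS ffactn1 natrM -ler_pdivlMr ?mul1r; last first.
  by rewrite mulr_gt0 ?ltr0n -?subn1 ?subn_gt0 // ltnW.
apply: le_trans; apply: mean_le => s _; rewrite ler_nat; case: andP => // -[sx sy].
by rewrite (_ : [forall p in _, _] = true) //; apply/forall_inP => p /set2P[] ->.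
Qed.

Lemma unif_mem_le (x : T) (A : {set T}) : unif (fun s => (s x \in A)%:R) <= #|A|%:R / n%:R.
Proof.
apply: le_trans (_ : \sum_(b in A) unif (fun s => (s x == b)%:R) <= _).
  rewrite -mean_sum; apply: mean_le => s _; case: (boolP (s x \in A)) => [sA|_].
    by rewrite (bigD1 (s x)) //= eqxx lerDl sumr_ge0.
  by rewrite sumr_ge0.
apply: le_trans (ler_sum _ (fun b _ => unif_single x b)) _.
by rewrite sumr_const mulr_natl.
Qed.

(** The upper bounds for [A] and for its complement add up to 1, so both are equalities. *)
Lemma unif_mem (x : T) (A : {set T}) : unif (fun s => (s x \in A)%:R) = #|A|%:R / n%:R.
Proof.
have n0 : (0 < n)%N by apply/card_gt0P; exists x.
apply/eqP; rewrite eq_le unif_mem_le /=.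
have := unif_mem_le x (~: A).
have -> : unif (fun s => (s x \in ~: A)%:R) = 1 - unif (fun s => (s x \in A)%:R).
  rewrite -[X in X - _](unif_cst 1) -mulN1r -meanZ -meanD; apply: eq_mean => s _.
  by rewrite inE; case: (s x \in A); rewrite /= ?mulN1r ?subrr ?oppr0 ?addr0.
rewrite cardsCs setCK natrB ?max_card// mulrBl divff ?pnatr_eq0 -?lt0n//.
by rewrite lerD2l lerN2.
Qed.

(** Negative correlation of draws without replacement: a (a - 1) / (n (n - 1)) <= (a / n)^2. *)
Lemma unif_mem2 (x y : T) (A : {set T}) : x != y ->
  unif (fun s => ((s x \in A) && (s y \in A))%:R) <= (#|A|%:R / n%:R) ^+ 2.
Proof.
move=> xy.
have n1 : (1 < n)%N by apply: leq_trans (max_card [set x; y]); rewrite cards2 xy.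
have n0 : (0 < n)%N by apply: ltnW.
apply: le_trans (_ : \sum_(b in A) \sum_(c in A :\ b)
    unif (fun s => ((s x == b) && (s y == c))%:R) <= _).
  under eq_bigr => b _ do rewrite -mean_sum.
  rewrite -mean_sum; apply: mean_le => s _; case: andP => [[sA tA]|_]; last first.
    by rewrite sumr_ge0// => b _; rewrite sumr_ge0.
  rewrite (bigD1 (s x)) //= (bigD1 (s y)) /=; last first.
    by rewrite !inE tA (inj_eq perm_inj) eq_sym xy.
  rewrite !eqxx -addrA lerDl addr_ge0 ?sumr_ge0// => b _.
  by rewrite sumr_ge0.
apply: le_trans (_ : \sum_(b in A) \sum_(c in A :\ b) (n%:R * n.-1%:R)^-1 <= _).
  by apply: ler_sum => b _; apply: ler_sum => c _; exact: unif_pair.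
rewrite (eq_bigr (fun=> (#|A|.-1)%:R * (n%:R * n.-1%:R)^-1)); last first.
  by move=> b bA; rewrite sumr_const (mulr_natl (_^-1)) [#|A|](cardsD1 b) bA.
rewrite sumr_const -mulrnAl -[_ *+ #|A|]mulr_natl.
rewrite invfM mulrACA expr2 ler_wpM2l ?mulr_ge0 ?invr_ge0//.
rewrite ler_pdivrMr ?ltr0n -?subn1 ?subn_gt0// mulrAC ler_pdivlMr ?ltr0n//.
by rewrite -!natrM ler_nat; have := max_card A; nia.
Qed.

(** The overlap has mean [mu] and, by negative correlation, variance at most [mu]. The event is a
    deviation of more than [mu / 2]. *)
Lemma unif_chebyshev (A B : {set T}) (mu := #|A|%:R * #|B|%:R / n%:R : R) :
  0 < mu -> unif (fun s => (#|(s @: B) :&: A|%:R < mu / 2 :> R)%:R) <= 4 / mu.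
Proof.
move=> mu0.
pose X (s : {perm T}) : R := \sum_(x in B) (s x \in A)%:R.
have XE (s : {perm T}) : #|(s @: B) :&: A|%:R = X s :> R.
  have -> : (s @: B) :&: A = s @: [set x in B | s x \in A].
    apply/setP => y; apply/setIP/imsetP => [[/imsetP[x xB ->] xA]|[x + ->]].
      by exists x; rewrite // inE xB.
    by rewrite inE => /andP[xB ->]; split => //; exact: imset_f.
  rewrite card_imset; last exact: perm_inj.
  rewrite -sum1_card natr_sum /X [LHS]big_mkcond [RHS]big_mkcond.
  by apply: eq_bigr => x _; rewrite inE; case: (x \in B); case: (s x \in A).
have EX : unif X = mu.
  rewrite /X mean_sum (eq_bigr (fun=> #|A|%:R / n%:R)); last first.
    by move=> x _; rewrite unif_mem.
  by rewrite sumr_const -(mulr_natl (_ / _)) mulrA [X in X / _]mulrC.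
have EX2 : unif (fun s => X s ^+ 2) <= mu + mu ^+ 2.
  have -> : unif (fun s => X s ^+ 2) =
      \sum_(x in B) \sum_(y in B) unif (fun s => ((s x \in A) && (s y \in A))%:R).
    under [RHS]eq_bigr => x _ do rewrite -mean_sum.
    rewrite -mean_sum; apply: eq_mean => s _; rewrite expr2 mulr_suml.
    apply: eq_bigr => x _; rewrite mulr_sumr; apply: eq_bigr => y _.
    by rewrite -natrM mulnb.
  apply: le_trans (_ : \sum_(x in B) (#|A|%:R / n%:R + #|B|%:R * (#|A|%:R / n%:R) ^+ 2) <= _).
    apply: ler_sum => x xB; rewrite (big_setD1 x) //=; apply: lerD.
      by rewrite -(unif_mem x); apply: mean_le => s _; rewrite andbb.
    apply: le_trans (_ : \sum_(y in B :\ x) (#|A|%:R / n%:R) ^+ 2 <= _).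
      by apply: ler_sum => y; rewrite !inE => /andP[yx _]; rewrite unif_mem2// eq_sym.
    rewrite sumr_const -(mulr_natl (_ ^+ 2)) ler_wpM2r ?exprn_ge0 ?mulr_ge0 ?invr_ge0//.
    by rewrite ler_nat subset_leq_card// subD1set.
  rewrite sumr_const -(mulr_natl (_ + _)) le_eqVlt; apply/orP; left; apply/eqP.
  by rewrite /mu; ring.
apply: le_trans (_ : unif (fun s => 4 / mu ^+ 2 * (X s ^+ 2 + (- 2 * mu) * X s + mu ^+ 2)) <= _).
  apply: mean_le => s _; rewrite XE.
  have -> : X s ^+ 2 + (- 2 * mu) * X s + mu ^+ 2 = (X s - mu) ^+ 2 by ring.
  case: (boolP (X s < mu / 2)) => [lt|_] /=; last by rewrite mulr_ge0 ?divr_ge0 ?sqr_ge0.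
  by rewrite mulrAC ler_pdivlMr ?exprn_gt0//; move: lt; nra.
rewrite meanZ !meanD meanZ EX unif_cst.
apply: le_trans (_ : 4 / mu ^+ 2 * mu <= _).
  by rewrite ler_wpM2l ?divr_ge0 ?sqr_ge0//; move: EX2; nra.
by rewrite expr2 invfM -!mulrA mulVf ?mulr1// gt_eqF.
Qed.

End RandomPerm.

(** * Total variation and transcripts *)

Section TotalVariation.
Variables (R : realType) (n : nat).
Implicit Types P : pairset n -> R.

Lemma dTV_le1 P P' : (forall x, 0 <= P x) -> (forall x, 0 <= P' x) ->
  \sum_x P x = 1 -> \sum_x P' x = 1 -> dTV P P' <= 1.
Proof.
move=> P0 P'0 P1 P'1; rewrite /dTV mulrC ler_pdivrMr// mul1r.
apply: le_trans (_ : \sum_x (P x + P' x) <= _); last first.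
  by rewrite big_split /= P1 P'1.
apply: ler_sum => x _; apply: le_trans (ler_normB _ _) _.
by rewrite !ger0_norm.
Qed.

(** Convexity of the total variation in its first argument; it permits conditioning on the positions
    of the centers. *)
Lemma dTV_mean (I : finType) (A : {set I}) (P : I -> pairset n -> R) P' :
  (0 < #|A|)%N ->
  dTV (fun x => mean A (P^~ x)) P' <= mean A (fun i => dTV (P i) P').
Proof.
move=> A0; rewrite /dTV meanZ mean_sum ler_wpM2l ?invr_ge0//.
apply: ler_sum => x _; rewrite -[X in _ - X](mean_cst (P' x) A0).
rewrite -mulN1r -meanZ -meanD; apply: le_trans (mean_norm _ _) _.
by apply: mean_le => i _; rewrite mulN1r.
Qed.

(* AM-GM: |P - P0| <= (eps P0 + (P - P0)^2 / (eps P0)) / 2 *)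
Lemma dTV_chi2 P P0 (eps : R) : 0 < eps ->
  (forall x, 0 <= P0 x) -> (forall x, P0 x = 0 -> P x = 0) ->
  \sum_x P x = 1 -> \sum_x P0 x = 1 ->
  dTV P P0 <= 4^-1 * (eps + (\sum_x P x ^+ 2 / P0 x - 1) / eps).
Proof.
move=> e0 P0_ge0 ac P1 P01.
apply: le_trans (_ : 2^-1 * \sum_x (2^-1 * (eps * P0 x +
   (P x ^+ 2 / P0 x - 2 * P x + P0 x) / eps)) <= _).
  rewrite ler_wpM2l ?invr_ge0//; apply: ler_sum => x _.
  have [p0|p0] := eqVneq (P0 x) 0.
    by rewrite ac ?p0// expr0n /= mul0r !mulr0 subr0 !addr0 mul0r addr0 mulr0 normr0.
  have pp : 0 < P0 x by rewrite lt_def p0 P0_ge0.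
  have -> : P x ^+ 2 / P0 x - 2 * P x + P0 x = `|P x - P0 x| ^+ 2 / P0 x.
    by rewrite real_normK ?num_real//; field.
  rewrite mulrC ler_pdivlMr//; set t := `|_|.
  have -> : eps * P0 x + t ^+ 2 / P0 x / eps =
     (eps * P0 x - t) ^+ 2 / (eps * P0 x) + t * 2 by field; rewrite p0 gt_eqF.
  by rewrite lerDr divr_ge0 ?sqr_ge0// mulr_ge0// ltW.
rewrite -mulr_sumr big_split /= -mulr_sumr -mulr_suml !big_split /= sumrN -mulr_sumr P1 P01.
rewrite le_eqVlt; apply/orP; left; apply/eqP; by field; rewrite gt_eqF.
Qed.

End TotalVariation.

(** * Transcripts as product laws and the overlap moment *)

Section ForcedLaw.
Local Open Scope set_scope.
Variables (R : realType) (q : R) (n : nat).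
Hypothesis q01 : 0 < q < 1.
Implicit Types E F Q x : pairset n.

(** Coordinates range over all vertex sets, not only pairs; probability 0 outside [pairs n] and 1 on
    [F] absorb the support condition of [forced_law]. *)
Definition eprob F (e : {set 'I_n}) : R :=
  if e \in F then 1 else if e \in pairs n then q else 0.

Lemma eprob01 F e : 0 <= eprob F e <= 1.
Proof.
by rewrite /eprob; case: ifP => _; [|case: ifP => _]; rewrite ?lexx ?ler01// !ltW; case/andP: q01.
Qed.

Lemma on_eprob01 Q F e : 0 <= on Q (eprob F) e <= 1.
Proof. by rewrite /on; case: ifP => _; rewrite ?eprob01// lexx ler01. Qed.

Lemma forced_lawE F E : F \subset pairs n -> forced_law q F E = wt (eprob F) E.
Proof.
move=> FP; rewrite /forced_law /wt; case: ifPn => [/andP[FE EP]|].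
  rewrite [RHS](bigID [in pairs n :\: F]) /= [X in _ = _ * X]big1 ?mulr1.
    apply: eq_bigr => e; rewrite /eprob inE => /andP[eF eP].
    by rewrite (negPf eF) eP.
  move=> e; rewrite inE negb_and negbK /eprob => /orP[eF|eP].
    by rewrite (subsetP FE) eF.
  have /negPf eE : e \notin E by apply: contra eP; exact: (subsetP EP).
  have /negPf eF : e \notin F by apply: contra eP; exact: (subsetP FP).
  by rewrite eE eF (negPf eP) subr0.
rewrite negb_and => /orP[] /subsetPn[e eX eY]; rewrite (bigD1 e) //= /eprob.
  by rewrite (negPf eY) eX subrr mul0r.
have /negPf eF : e \notin F by apply: contra eY; exact: (subsetP FP).
by rewrite eX eF (negPf eY) mul0r.
Qed.

Lemma transcript_forced F Q x : F \subset pairs n ->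
  transcript_law (forced_law q F) Q x = wt (on Q (eprob F)) x.
Proof.
move=> FP; rewrite -wt_marginal; apply: eq_bigr => E _; exact: forced_lawE.
Qed.

Lemma transcript_H0 Q x :
  transcript_law (@law_H0 R q n) Q x = wt (on Q (eprob set0)) x.
Proof. by rewrite -(transcript_forced _ _ (sub0set _)). Qed.

(** The sum factorizes. A coordinate contributes 1/q if the pair is queried and forced in both
    graphs, and 1 otherwise; outside [Q] this relies on 0 / 0 = 0. *)
Lemma overlap_moment F F' Q : F \subset pairs n -> F' \subset pairs n ->
  Q \subset pairs n ->
  \sum_x wt (on Q (eprob F)) x * wt (on Q (eprob F')) x / wt (on Q (eprob set0)) x =
  q^-1 ^+ #|F :&: F' :&: Q|.
Proof.
move=> FP FP' QP; have /andP[q0 q1] := q01.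
have qn : q != 0 by rewrite gt_eqF.
have qn1 : 1 - q != 0 by rewrite subr_eq0 gt_eqF.
rewrite wt_pair (bigID [in F :&: F' :&: Q]) /= [X in _ * X]big1 ?mulr1.
  rewrite (eq_bigr (fun=> q^-1)) ?prodr_const// => e.
  rewrite !inE /on /eprob => /andP[/andP[-> ->] eQ].
  by rewrite eQ in_set0 (subsetP QP) //; field; rewrite qn.
move=> e; rewrite !inE /on /eprob in_set0.
case: (boolP (e \in Q)) => [eQ|_ _]; last by rewrite !mul0r add0r !subr0 !mul1r invr1.
rewrite (subsetP QP _ eQ).
by case: (e \in F); case: (e \in F') => //= _; field; rewrite ?qn ?qn1.
Qed.

Lemma mixture_dTV (I : finType) (A : {set I}) (F : I -> pairset n) Q (eps : R) :
  (0 < #|A|)%N -> (forall i, F i \subset pairs n) -> Q \subset pairs n -> 0 < eps ->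
  dTV (fun x => mean A (fun i => wt (on Q (eprob (F i))) x)) (wt (on Q (eprob set0))) <=
  4^-1 * (eps + (mean A (fun i => mean A (fun j =>
      q^-1 ^+ #|F i :&: F j :&: Q|)) - 1) / eps).
Proof.
move=> A0 FP QP e0; have /andP[q0 q1] := q01.
apply: le_trans (dTV_chi2 e0 _ _ _ _) _.
- by move=> x; apply: wt_ge0 => e; exact: on_eprob01.
(* Absolute continuity: as 0 < q < 1, a vanishing factor under the null law comes from a coordinate
   of [x] outside [Q], and there every planted law vanishes too. *)
- move=> x /eqP; rewrite prodf_seq_eq0 => /hasP[e _ /= h].
  rewrite (eq_mean (g := fun=> 0)); first by rewrite mean_cst.
  move=> i _; apply/eqP; rewrite prodf_seq_eq0; apply/hasP; exists e; rewrite ?mem_index_enum//=.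
  move: h; rewrite /on /eprob in_set0; case: (boolP (e \in Q)) => // eQ.
  by rewrite (subsetP QP) //; case: (e \in x); rewrite ?subr_eq0 gt_eqF.
- rewrite -mean_sum (eq_mean (g := fun=> 1)) ?mean_cst// => i _; exact: wt_sum1.
- exact: wt_sum1.
suff -> : \sum_x mean A (fun i => wt (on Q (eprob (F i))) x) ^+ 2 / wt (on Q (eprob set0)) x =
    mean A (fun i => mean A (fun j => q^-1 ^+ #|F i :&: F j :&: Q|)) by [].
under eq_bigr => x _.
  rewrite expr2 -mean_mul mulrC -meanZ.
  under eq_mean => i _ do rewrite -meanZ.
  over.
rewrite -mean_sum; apply: eq_mean => i _; rewrite -mean_sum; apply: eq_mean => j _.
by rewrite -overlap_moment //; apply: eq_bigr => x _; rewrite mulrC.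
Qed.

End ForcedLaw.

(** * Embeddings, copies and their relabelling by permutations *)

Section Copies.
Local Open Scope set_scope.
Variables (G : sgraph) (n : nat).

Definition emb (f : G -> 'I_n) : pairset n := [set f @: e | e : {set G} in edges G].

Definition img (s : {perm 'I_n}) (F : pairset n) : pairset n := [set s @: e | e : {set 'I_n} in F].

Lemma embP (f : G -> 'I_n) (e : {set 'I_n}) :
  reflect (exists u w, adj u w /\ e = [set f u; f w]) (e \in emb f).
Proof.
apply: (iffP imsetP) => [[e' /imsetP[[u w]] + -> ->]|[u [w [uw ->]]]].
  by rewrite inE /= => uw; exists u, w; rewrite imsetU1 imset_set1.
exists [set u; w]; last by rewrite imsetU1 imset_set1.
by apply/imsetP; exists (u, w); rewrite ?inE.
Qed.

Lemma emb_sub (f : G -> 'I_n) : injective f -> emb f \subset pairs n.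
Proof.
move=> fI; apply/subsetP => _ /embP[u [w [uw ->]]].
by rewrite inE cards2 (inj_eq fI); case: (eqVneq u w) uw => // ->; rewrite adj_irr.
Qed.

Lemma img_emb (s : {perm 'I_n}) (f : G -> 'I_n) : img s (emb f) = emb (s \o f).
Proof.
by rewrite /img /emb -imset_comp; apply: eq_imset => e /=; rewrite -imset_comp.
Qed.

Lemma imgM (s t : {perm 'I_n}) F : img s (img t F) = img (t * s)%g F.
Proof.
rewrite /img -imset_comp; apply: eq_imset => e /=; rewrite -imset_comp.
by apply: eq_imset => x /=; rewrite permM.
Qed.

Lemma img1 F : img 1%g F = F.
Proof.
rewrite /img -[RHS]imset_id; apply: eq_imset => e.
by rewrite -[RHS]imset_id; apply: eq_imset => x; rewrite perm1.
Qed.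

Lemma copies_emb H : H \in copies G n -> exists2 f : G -> 'I_n, injective f & H.2 = emb f.
Proof.
rewrite inE => /existsP[f /and3P[/injectiveP fI _ /eqP ->]].
by exists f.
Qed.

Lemma copies_gt0 : (#|G| <= n)%N -> (0 < #|copies G n|)%N.
Proof.
move=> Gn; pose f : {ffun G -> 'I_n} := [ffun u => widen_ord Gn (enum_rank u)].
apply/card_gt0P; exists (f @: setT, emb f); rewrite inE; apply/existsP; exists f.
rewrite !eqxx !andbT; apply/injectiveP => u v; rewrite !ffunE => /(congr1 val) /= h.
exact/enum_rank_inj/val_inj.
Qed.

Definition act (s : {perm 'I_n}) (H : {set 'I_n} * pairset n) := (s @: H.1, img s H.2).

Lemma act_copies s H : H \in copies G n -> act s H \in copies G n.
Proof.
rewrite !inE => /existsP[f /and3P[/injectiveP fI /eqP H1 /eqP H2]].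
apply/existsP; exists [ffun x => s (f x)]; apply/and3P; split.
- by apply/injectiveP => x y; rewrite !ffunE => /perm_inj /fI.
- apply/eqP; rewrite /= H1 -imset_comp; apply: eq_imset => x; by rewrite ffunE.
- apply/eqP; rewrite /= H2 [img _ _]img_emb; apply: eq_imset => e /=.
  by apply: eq_imset => x; rewrite ffunE.
Qed.

Lemma act_comp s t H : act s (act t H) = act (t * s)%g H.
Proof.
rewrite /act /= imgM -imset_comp; congr (_, _).
by apply: eq_imset => x /=; rewrite permM.
Qed.

Lemma act1 H : act 1%g H = H.
Proof.
case: H => V F; rewrite /act /= img1; congr (_, _).
by rewrite -[RHS]imset_id; apply: eq_imset => x; rewrite perm1.
Qed.

(** Relabelling permutes the set of copies, so an extra uniform permutation leaves the law
    unchanged. Afterwards each copy may be held fixed, all the randomness being in the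
    permutation. *)
Lemma law_H1_mean (R : realType) (q : R) (E : pairset n) :
  law_H1 q G E = mean (copies G n) (fun H =>
    mean setT (fun s : {perm 'I_n} => forced_law q (img s H.2) E)).
Proof.
rewrite mean_exchange -[LHS](@unif_cst R 'I_n); apply: eq_mean => s _.
rewrite -[LHS]/(mean (copies G n) (fun H => forced_law q H.2 E)).
rewrite (@mean_reindex _ _ _ (act s)) //.
  by apply: (can_inj (g := act s^-1%g)) => H; rewrite act_comp mulgV act1.
move=> H; apply/idP/idP => [|h]; last exact: act_copies.
by move=> /(act_copies s^-1%g); rewrite act_comp mulgV act1.
Qed.

End Copies.

(** * Second moment for fixed positions of the centers *)

Section LowerBound.
Local Open Scope set_scope.
Variables (R : realType) (q : R) (n : nat) (G : sgraph) (U : {set G}).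
Hypotheses (q01 : 0 < q < 1) (isoG : no_isolated G) (covU : vertex_cover U)
  (indU : edgeless_on U) (uniqU : unique_cover_neighbor U) (Gn : (#|G| <= n)%N).
Variables (Q : pairset n) (b : nat).
Hypotheses (QP : Q \subset pairs n) (Qb : (#|Q| <= b)%N).

Section OneCopy.
Variable f : G -> 'I_n.
Hypothesis fI : injective f.

(** The points free of centers, and the leaf points of each star. Non-centers get an empty leaf set,
    so that the family is disjoint over all vertices. *)
Let A := ~: (f @: U).
Let L (u : G) : {set 'I_n} := if u \in U then f @: neighbors u else set0.

Lemma leaf_sites_sub u : L u \subset A.
Proof.
rewrite /L; case: ifP => [uU|_]; last exact: sub0set.
apply/subsetP => _ /imsetP[w + ->]; rewrite !inE (mem_imset _ _ fI).
exact: adj_cover.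
Qed.

Lemma leaf_sites_disj u v y : y \in L u -> y \in L v -> u = v.
Proof.
rewrite /L; case: ifP => [uU|_]; last by rewrite inE.
case: ifP => [vU|_]; last by rewrite inE.
move=> /imsetP[w uw ->] /imsetP[w' vw' /fI ww'].
by move: uw vw'; rewrite !inE -ww' => uw vw; exact: (leaf_center indU uniqU uU vU uw vw).
Qed.

Lemma card_leaf_sites u : u \in U -> #|L u| = dW U u.
Proof. by move=> uU; rewrite /L uU card_imset// -(deg_cover indU). Qed.

(** [t] will permute [A], hence fix the centers and shuffle the leaves; [s] then relabels everything
    and alone decides where the centers go. *)
Definition planted (s t : {perm 'I_n}) : pairset n := img s (img t (emb f)).

(** The queried pairs that can be planted once [s] has placed the centers. The second component is a
    point before relabelling by [s]. *)
Definition sites (s : {perm 'I_n}) : {set G * 'I_n} :=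
  [set p | [&& p.1 \in U, p.2 \in A & [set s (f p.1); s p.2] \in Q]].

Definition site_weight (p : G * 'I_n) : R := expR 1 * #|L p.1|%:R / #|A|%:R.

Definition site_cost (s : {perm 'I_n}) : R := \sum_(p in sites s) site_weight p ^+ 2.

(** Every edge has an endpoint in the cover. [t] fixes that center, and the inverse of [t] brings
    the other end back to a leaf point. *)
Lemma planted_site s t e : t \in Sym A -> e \in planted s t -> e \in Q ->
  exists p, [/\ p \in sites s, t^-1%g p.2 \in L p.1 & e = [set s (f p.1); s p.2]].
Proof.
rewrite inE /planted !img_emb => tA /embP[u0 [w0 [uw0 e0]]] eQ.
have [u [w [uU uw eE]]] :
    exists u w, [/\ u \in U, adj u w & e = [set s (t (f u)); s (t (f w))]].
  case/orP: (covU uw0) => [uU|wU]; first by exists u0, w0.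
  by exists w0, u0; split=> //; [rewrite adj_sym | rewrite e0 setUC].
have wU := adj_cover indU uU uw.
have tu : t (f u) = f u by rewrite (out_perm tA) // inE negbK imset_f.
have wA : f w \in A by rewrite inE (mem_imset _ _ fI).
exists (u, t (f w)); split => /=; last by rewrite eE tu.
  by rewrite inE /= uU -tu -eE eQ (perm_closed _ tA) wA.
by rewrite permK /L uU; apply: imset_f; rewrite inE.
Qed.

(** Centers and points of [A] stay disjoint under [s], so an unordered pair reveals which of its
    ends is the center. *)
Lemma site_edge_inj s : {in sites s &, injective (fun p => [set s (f p.1); s p.2])}.
Proof.
move=> [u x] [v y]; rewrite [_ \in _]inE [_ \in sites s]inE /= => /and3P[uU xA _] /and3P[vU yA _] /= h.
have ne w z : w \in U -> z \in A -> (s (f w) == s z) = false.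
  move=> wU; rewrite inE (inj_eq perm_inj); apply: contraNF => /eqP <-.
  exact: imset_f.
have : s (f u) \in [set s (f v); s y] by rewrite -h set21.
rewrite !inE (ne u y) // orbF (inj_eq perm_inj) (inj_eq fI) => /eqP ->.
have : s x \in [set s (f v); s y] by rewrite -h set22.
by rewrite !inE [s x == s (f v)]eq_sym (ne v x) //= (inj_eq perm_inj) => /eqP ->.
Qed.

Lemma overlap_le s t t' : t \in Sym A -> t' \in Sym A ->
  (#|planted s t :&: planted s t' :&: Q| <=
   #|[set p in sites s | (t^-1%g p.2 \in L p.1) && (t'^-1%g p.2 \in L p.1)]|)%N.
Proof.
move=> tA t'A; apply: leq_trans (leq_imset_card (fun p => [set s (f p.1); s p.2]) _).
apply/subset_leq_card/subsetP => e; rewrite !inE => /andP[/andP[et et'] eQ].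
have [p [pS pt ep]] := planted_site tA et eQ.
have [p' [p'S p't ep']] := planted_site t'A et' eQ.
have pp' : p = p' by apply: (site_edge_inj pS p'S); rewrite -ep.
by apply/imsetP; exists p; rewrite // inE pS pt pp'.
Qed.

(* Expanding [lambda^|overlap| = prod (1 + (lambda - 1) 1)] over sets S of sites
   decouples the two replicas, whose contributions are bounded by [hits_prob]. *)
Lemma replica_bound s :
  mean (Sym A) (fun t => mean (Sym A) (fun t' =>
    q^-1 ^+ #|planted s t :&: planted s t' :&: Q|)) <=
  expR ((q^-1 - 1) * site_cost s).
Proof.
have /andP[q0 q1] := q01.
have l1 : 1 <= q^-1 by rewrite invr_ge1 ?unitfE ?gt_eqF// ltW.
pose l := q^-1 - 1; have l0 : 0 <= l by rewrite subr_ge0.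
pose h (S : {set G * 'I_n}) (t : {perm 'I_n}) : R := (t^-1%g \in hits A L S)%:R.
pose w (S : {set G * 'I_n}) : R := \prod_(p in S) (l * (p \in sites s)%:R).
have w0 S : 0 <= w S by apply: prodr_ge0 => p _; rewrite mulr_ge0.
have bound t t' : t \in Sym A -> t' \in Sym A ->
    q^-1 ^+ #|planted s t :&: planted s t' :&: Q| <= \sum_S w S * (h S t * h S t').
  move=> tA t'A; apply: le_trans (ler_weXn2l l1 (overlap_le s tA t'A)) _.
  have -> : q^-1 ^+ #|[set p in sites s | (t^-1%g p.2 \in L p.1) && (t'^-1%g p.2 \in L p.1)]| =
      \prod_p (l * ((p \in sites s) && ((t^-1%g p.2 \in L p.1) && (t'^-1%g p.2 \in L p.1)))%:R + 1).
    rewrite -prodr_const big_mkcond /=; apply: eq_bigr => p _; rewrite inE.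
    by case: (_ && _); rewrite ?mulr1 ?mulr0 ?add0r// /l subrK.
  rewrite bigA_distr; apply: ler_sum => S _; rewrite -big_mkcond /=.
  have [h1|] := boolP [forall p in S, (t^-1%g p.2 \in L p.1) && (t'^-1%g p.2 \in L p.1)].
    rewrite /h !(introT (hitsP _ _ _ _)) ?mulr1.
    - apply: ler_prod => p pS; rewrite mulr_ge0//=.
      by rewrite ler_wpM2l// ler_nat; case: (p \in sites s); rewrite ?leq_b1.
    - split=> [|p pS]; last by have /forall_inP/(_ p pS)/andP[] := h1.
      by rewrite perm_onV //; rewrite inE in t'A.
    - split=> [|p pS]; last by have /forall_inP/(_ p pS)/andP[] := h1.
      by rewrite perm_onV //; rewrite inE in tA.
  rewrite negb_forall => /existsP[p]; rewrite negb_imply => /andP[pS /negPf np].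
  by rewrite (bigD1 p) //= np andbF mulr0 mul0r !mulr_ge0.
apply: le_trans (_ : \sum_S w S * mean (Sym A) (h S) ^+ 2 <= _).
  under [leRHS]eq_bigr => S _.
    rewrite expr2 -mean_mul -meanZ.
    under eq_mean => t _ do rewrite -meanZ.
    over.
  rewrite -mean_sum; apply: mean_le => t tA; rewrite -mean_sum.
  by apply: mean_le => t' t'A; exact: bound.
have hS S : mean (Sym A) (h S) <= \prod_(p in S) site_weight p.
  apply: le_trans _ (hits_prob R leaf_sites_sub leaf_sites_disj S).
  (* [hits] speaks of the inverse of the leaf permutation, which is uniform on [Sym A] as well. *)
  rewrite [leRHS](mean_reindex (h := invg)) //; first exact: invg_inj.
  move=> t; rewrite !inE; apply/idP/idP => [|h']; last by rewrite perm_onV.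
  by move=> /perm_onV; rewrite invgK.
apply: le_trans (_ : \sum_(S : {set G * 'I_n}) \prod_(p in S) (l * (p \in sites s)%:R * site_weight p ^+ 2) <= _).
  apply: ler_sum => S _; rewrite big_split /= ler_wpM2l ?w0// prodrXl lerXn2r ?nnegrE ?hS//.
    by apply: mean_ge0.
  by apply: prodr_ge0 => p _; rewrite /site_weight !mulr_ge0 ?expR_ge0 ?invr_ge0.
(* The sum over [S] folds back into a product of factors 1 + x, each at most exp x. *)
under eq_bigr => S _ do rewrite big_mkcond.
rewrite -bigA_distr /= -/l /site_cost mulr_sumr [in leRHS]big_mkcond expR_sum /=.
apply: ler_prod => p _; rewrite addr_ge0 ?mulr_ge0 ?sqr_ge0//= addrC.
case: (p \in sites s); last by rewrite mulr0 mul0r addr0 expR0.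
by rewrite mulr1 expR_ge1Dx.
Qed.

Lemma card_leaf_space : (n <= 2 * #|A|)%N.
Proof.
rewrite cardsCs setCK card_ord (card_imset _ fI).
have := card_cover_leaves U; have := card_cover_le isoG indU uniqU; move: Gn; lia.
Qed.

Lemma planted_sub s t : planted s t \subset pairs n.
Proof.
by rewrite /planted !img_emb; apply: emb_sub => u v /perm_inj /perm_inj /fI.
Qed.

Lemma site_cost_ge0 s : 0 <= site_cost s.
Proof. by apply: sumr_ge0 => p _; exact: sqr_ge0. Qed.

(** If the exponent z is at most 1/2, then e^z - 1 <= 2 z enters the chi-square bound; otherwise 2 z
    already exceeds the trivial bound 1. The result is linear in [site_cost s], so it can be
    averaged over [s]. *)
Lemma copy_dTV s (eps : R) : 0 < eps ->
  dTV (fun x => mean (Sym A) (fun t => wt (on Q (eprob q (planted s t))) x))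
      (wt (on Q (eprob q set0))) <=
  eps / 4 + (2 + (2 * eps)^-1) * ((q^-1 - 1) * site_cost s).
Proof.
move=> e0; have /andP[q0 q1] := q01; set z := _ * site_cost s.
have z0 : 0 <= z.
  by rewrite mulr_ge0 ?site_cost_ge0// subr_ge0 invr_ge1 ?unitfE ?gt_eqF// ltW.
have SA : (0 < #|Sym A|)%N by apply/card_gt0P; exists 1%g; rewrite inE perm_on1.
have [z1|z1] := leP z 2^-1.
  apply: le_trans (mixture_dTV q01 SA (planted_sub s) QP e0) _.
  have h1 := replica_bound s; have h2 := expR_le_sqr z1.
  have h3 : mean (Sym A) (fun t => mean (Sym A) (fun t' =>
      q^-1 ^+ #|planted s t :&: planted s t' :&: Q|)) - 1 <= 2 * z.
    by apply: le_trans (_ : expR z - 1 <= _); [rewrite lerD2r | nra].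
  apply: le_trans (_ : 4^-1 * (eps + 2 * z / eps) <= _).
    by rewrite ler_wpM2l ?invr_ge0// lerD2l ler_wpM2r ?invr_ge0// ltW.
  have -> : 4^-1 * (eps + 2 * z / eps) = eps / 4 + (2 * eps)^-1 * z.
    by field; rewrite gt_eqF.
  by rewrite lerD2l ler_wpM2r// lerDr.
apply: le_trans (_ : 1 <= _).
  apply: dTV_le1.
  - by move=> x; apply: mean_ge0 => t _; apply: wt_ge0 => e; exact: on_eprob01.
  - by move=> x; apply: wt_ge0 => e; exact: on_eprob01.
  - by rewrite -mean_sum -[RHS](mean_cst 1 SA); apply: eq_mean => t _; exact: wt_sum1.
  - exact: wt_sum1.
have e1 : 0 <= eps := ltW e0.
have r0 : 0 <= (2 * eps)^-1 * z by apply: mulr_ge0 => //; rewrite invr_ge0 mulr_ge0.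
rewrite mulrDl; lra.
Qed.

(** Each queried pair is hit in one of two orders, each with probability at most 1 / (n (n - 1)),
    and 2 / (n (n - 1)) <= 4 / n^2. *)
Lemma unif_edge (a x : 'I_n) : a != x ->
  mean setT (fun s : {perm 'I_n} => ([set s a; s x] \in Q)%:R) <= 4 * b%:R / n%:R ^+ 2 :> R.
Proof.
move=> ax.
have n1 : (1 < n)%N.
  by rewrite -[n]card_ord; apply: leq_trans (max_card [set a; x]); rewrite cards2 ax.
have n0 : (0 < n%:R :> R) by rewrite ltr0n ltnW.
apply: le_trans (_ : \sum_(e in Q) mean setT (fun s : {perm 'I_n} => (e == [set s a; s x])%:R) <= _).
  rewrite -mean_sum; apply: mean_le => s _; case: (boolP (_ \in Q)) => [eQ|_].
    by rewrite (bigD1 [set s a; s x]) //= eqxx lerDl sumr_ge0.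
  by rewrite sumr_ge0.
apply: le_trans (_ : \sum_(e in Q) (4 / n%:R ^+ 2) <= _); last first.
  rewrite sumr_const -(mulr_natl (4 / _)) [leRHS]mulrAC [leRHS]mulrC.
  by rewrite ler_wpM2r ?ler_nat// divr_ge0 ?exprn_ge0.
apply: ler_sum => e eQ; have := subsetP QP _ eQ.
rewrite inE => /cards2P[c [d [cd ->]]].
apply: le_trans (_ : mean setT (fun s : {perm 'I_n} => ((s a == c) && (s x == d))%:R
    + ((s a == d) && (s x == c))%:R) <= _).
  apply: mean_le => s _; case: eqP => [h|_]; last by rewrite addr_ge0.
  have : s a \in [set c; d] by rewrite h set21.
  have : s x \in [set c; d] by rewrite h set22.
  have sax : (s x == s a) = false by rewrite (inj_eq perm_inj) eq_sym (negPf ax).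
  rewrite !inE => /orP[]/eqP sx /orP[]/eqP sa; move: sax; rewrite sx sa ?eqxx //= => _.
    by rewrite lerDr.
  by rewrite lerDl.
rewrite meanD; apply: le_trans (lerD (unif_pair _ _ _ ax) (unif_pair _ _ _ ax)) _.
rewrite card_ord -mulr2n -(mulr_natl _^-1) ler_pdivlMr ?exprn_gt0//.
rewrite mulrAC ler_pdivrMr; last by rewrite mulr_gt0 ?ltr0n -?subn1 ?subn_gt0// ltnW.
by rewrite -!natrX -!natrM ler_nat; nia.
Qed.

(** Summing (e d_u / |A|)^2 over u and the points of A, with probability 4 b / n^2 for each site,
    gives 4 e^2 S_2 b / (|A| n^2); then |A| >= n/2 produces the 8. *)
Lemma site_cost_mean :
  mean setT site_cost <= 8 * expR 1 ^+ 2 * (S2 U)%:R * b%:R / n%:R ^+ 3.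
Proof.
have [U0|[u0 u0U]] := set_0Vmem U.
  rewrite /mean big1 ?mulr0; first by rewrite !mulr_ge0 ?sqr_ge0 ?invr_ge0 ?exprn_ge0.
  by move=> s _; rewrite /site_cost big1// => p; rewrite !inE U0 inE.
have n0 : (0 < n)%N by rewrite -[n]card_ord; apply/card_gt0P; exists (f u0).
have N0 : (0 < #|A|)%N by have := card_leaf_space; lia.
pose c := expR 1 / #|A|%:R : R.
have -> : mean setT site_cost = \sum_(u in U) \sum_(x in A)
    (c * (dW U u)%:R) ^+ 2 * mean setT (fun s : {perm 'I_n} => ([set s (f u); s x] \in Q)%:R).
  under [RHS]eq_bigr => u _.
    under eq_bigr => x _ do rewrite -meanZ.
    rewrite -mean_sum; over.
  rewrite -mean_sum; apply: eq_mean => s _; rewrite pair_big_dep /site_cost /=.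
  rewrite big_mkcond [RHS]big_mkcond; apply: eq_bigr => -[u x] _; rewrite [in LHS]inE /=.
  case: (boolP (u \in U)) => //= uU; case: (boolP (x \in A)) => //= _.
  case: (_ \in Q); last by rewrite mulr0.
  by rewrite mulr1 /site_weight /= card_leaf_sites// /c mulrAC.
apply: le_trans (_ : \sum_(u in U) \sum_(x in A) (c * (dW U u)%:R) ^+ 2 * (4 * b%:R / n%:R ^+ 2) <= _).
  apply: ler_sum => u uU; apply: ler_sum => x; rewrite inE => xA.
  rewrite ler_wpM2l ?sqr_ge0// unif_edge//.
  by apply: contraNneq xA => <-; exact: imset_f.
under eq_bigr => u _ do rewrite sumr_const -(mulr_natl (_ * _)) exprMn.
have -> : \sum_(u in U) #|A|%:R * (c ^+ 2 * (dW U u)%:R ^+ 2 * (4 * b%:R / n%:R ^+ 2)) =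
    (S2 U)%:R * (#|A|%:R * c ^+ 2 * (4 * b%:R / n%:R ^+ 2)).
  rewrite /S2 natr_sum mulr_suml; apply: eq_bigr => u _; rewrite natrX; ring.
have -> : 8 * expR 1 ^+ 2 * (S2 U)%:R * b%:R / n%:R ^+ 3 =
    (S2 U)%:R * (expR 1 ^+ 2 * (2 / n%:R) * (4 * b%:R / n%:R ^+ 2)) :> R.
  by field; rewrite pnatr_eq0 -lt0n.
rewrite ler_wpM2l// ler_wpM2r ?mulr_ge0 ?invr_ge0 ?exprn_ge0//.
have -> : #|A|%:R * c ^+ 2 = expR 1 ^+ 2 * #|A|%:R^-1.
  by rewrite /c; field; rewrite pnatr_eq0 -lt0n.
rewrite ler_wpM2l ?sqr_ge0// ler_pdivlMr ?ltr0n// mulrC ler_pdivrMr ?ltr0n//.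
by rewrite -natrM ler_nat card_leaf_space.
Qed.

End OneCopy.

Lemma detection_dTV (eps : R) : 0 < eps ->
  dTV (transcript_law (law_H1 q G) Q) (transcript_law (@law_H0 R q n) Q) <=
  eps / 4 + (2 + (2 * eps)^-1) *
    ((q^-1 - 1) * (8 * expR 1 ^+ 2 * (S2 U)%:R * b%:R / n%:R ^+ 3)).
Proof.
move=> e0; have /andP[q0 q1] := q01; set z := _ * (_ * _).
have c0 := copies_gt0 Gn; have e1 := ltW e0.
have l0 : 0 <= q^-1 - 1 by rewrite subr_ge0 ltW// invf_gt1.
have r0 : 0 <= 2 + (2 * eps)^-1 by rewrite addr_ge0 ?invr_ge0 ?mulr_ge0.
have z0 : 0 <= z by rewrite /z mulr_ge0// !mulr_ge0 ?invr_ge0 ?exprn_ge0 ?expR_ge0.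
pose T (F : pairset n) x : R := wt (on Q (eprob q F)) x.
have -> : transcript_law (law_H1 q G) Q =
    (fun x => mean (copies G n) (fun H => mean setT (fun s : {perm 'I_n} => T (img s H.2) x))).
  apply/funext => x; rewrite /transcript_law.
  under eq_bigr => E _ do rewrite law_H1_mean.
  rewrite -mean_sum; apply: eq_mean => H /copies_emb[f fI ->].
  rewrite -mean_sum; apply: eq_mean => s _; rewrite /T -transcript_forced//.
  by rewrite img_emb; apply: emb_sub => u v /perm_inj /fI.
have -> : transcript_law (@law_H0 R q n) Q = T set0 by apply/funext => x; exact: transcript_H0.
apply: le_trans (dTV_mean (fun H x => mean setT (fun s : {perm 'I_n} => T (img s H.2) x)) _ c0) _.
apply: mean_le_cst => [|H /copies_emb[f fI ->]].
  by rewrite addr_ge0 ?(mulr_ge0 r0 z0) ?divr_ge0.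
set A := ~: (f @: U).
have SA : (0 < #|Sym A|)%N by apply/card_gt0P; exists 1%g; rewrite inE perm_on1.
(* Composing with any fixed [t] keeps [s] uniform, so the leaf permutation can be inserted for
   free. *)
have -> : (fun x => mean setT (fun s : {perm 'I_n} => T (img s (emb f)) x)) =
    (fun x => mean setT (fun s => mean (Sym A) (fun t => T (planted f s t) x))).
  apply/funext => x; rewrite mean_exchange -[LHS](mean_cst _ SA).
  apply: eq_mean => t _; rewrite (mean_reindex (h := fun s => (t * s)%g)).
  - by apply: eq_mean => s _; rewrite /planted imgM.
  - exact: mulgI.
  - by move=> s; rewrite !inE.
have s0 : (0 < #|[set: {perm 'I_n}]|)%N by apply/card_gt0P; exists 1%g; rewrite inE.
apply: le_trans (dTV_mean (fun s x => mean (Sym A) (fun t => T (planted f s t) x)) _ s0) _.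
apply: le_trans (mean_le (fun s _ => copy_dTV fI s e0)) _.
rewrite meanD mean_cst// lerD2l meanZ meanZ; do 2![apply: ler_wpM2l => //].
exact: site_cost_mean.
Qed.

End LowerBound.

(** * The scan test *)

Section UpperBound.
Local Open Scope set_scope.
Variables (R : realType) (q : R) (n : nat) (A M : {set 'I_n}) (y : R).
Hypothesis q01 : 0 < q < 1.

(** [A] and [M] may intersect, so [v] is removed from [M]. This loses at most one pair, whence the
    [m - 1] in the lower bound for the planted mean. *)
Definition star (v : 'I_n) : pairset n := [set [set v; x] | x in M :\ v].
Definition star_query : pairset n := \bigcup_(v in A) star v.
Definition scan (x : pairset n) : bool := [exists v in A, y <= #|x :&: star v|%:R].

Variable m : R.
Hypothesis mE : #|M|%:R = m.

Lemma star_inj (v : 'I_n) : {in M :\ v &, injective (fun x => [set v; x])}.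
Proof.
move=> x z; rewrite !inE => /andP[xv _] _ h.
have : x \in [set v; z] by rewrite -h set22.
by rewrite !inE (negPf xv) => /eqP.
Qed.

Lemma card_star_le v : (#|star v| <= #|M|)%N.
Proof. by rewrite (leq_trans (leq_imset_card _ _)) ?subset_leq_card ?subD1set. Qed.

Lemma star_query_sub : star_query \subset pairs n.
Proof.
apply/bigcupsP => v _; apply/subsetP => _ /imsetP[x + ->].
by rewrite !inE cards2 eq_sym => /andP[->].
Qed.

Lemma card_star_query : (#|star_query| <= #|A| * #|M|)%N.
Proof.
rewrite -sum_nat_const /star_query.
elim/big_rec2: _ => [|v k B _ IH]; first by rewrite cards0.
by rewrite (leq_trans (leq_card_setU _ _))// leq_add// card_star_le.
Qed.

Lemma star_sub v e : v \in A -> e \in star v -> e \in star_query.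
Proof. by move=> vA; apply: (subsetP (bigcup_sup v vA)). Qed.

Section Null.
Variable t : R.
Hypotheses (t0 : 0 < t) (tm : t <= 2 * m) (yE : y = q * m + t).

(** Union bound over [A], then Chernoff with s = t / (4 m): the exponent is - s t + 2 s^2 m = - t^2
    / (8 m), and [t <= 2 * m] ensures s <= 1/2. *)
Lemma scan_null :
  \sum_x transcript_law (@law_H0 R q n) star_query x * (scan x)%:R <=
  #|A|%:R * expR (- (t ^+ 2 / (8 * m))).
Proof.
have /andP[q0 q1] := q01; have m0 : 0 < m by move: t0 tm; lra.
apply: le_trans (_ : \sum_(v in A)
    \sum_(x | t / (4 * m) * y <= t / (4 * m) * #|x :&: star v|%:R)
       wt (on star_query (eprob q set0)) x <= _).
  under [leRHS]eq_bigr => v _ do rewrite big_mkcond.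
  rewrite exchange_big /=; apply: ler_sum => x _; rewrite transcript_H0.
  have w0 : 0 <= wt (on star_query (eprob q set0)) x.
    by apply: wt_ge0 => e; exact: on_eprob01.
  have s0 v : 0 <= (if t / (4 * m) * y <= t / (4 * m) * #|x :&: star v|%:R
     then wt (on star_query (eprob q set0)) x else 0) by case: ifP.
  rewrite /scan; case: (boolP [exists v in A, _]) => [/existsP[v /andP[vA yv]]|_]; last first.
    by rewrite mulr0 sumr_ge0.
  rewrite mulr1 (bigD1 v) //= ifT ?lerDl ?sumr_ge0//.
  by rewrite ler_wpM2l// divr_ge0 ?mulr_ge0// ltW.
set z := expR _; have -> : #|A|%:R * z = \sum_(v in A) z by rewrite sumr_const mulr_natl.
rewrite {}/z; apply: ler_sum => v vA.
apply: le_trans (wt_tail (star v) y (on_eprob01 q01 _ _) _) _.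
  rewrite ler_pdivrMr ?mulr_gt0//; move: tm; lra.
have -> : \sum_(e in star v) on star_query (eprob q set0) e = q * #|star v|%:R.
  rewrite (eq_bigr (fun=> q)) ?sumr_const ?mulr_natr// => e ev.
  by rewrite /on /eprob (star_sub vA ev) in_set0 (subsetP star_query_sub) // (star_sub vA ev).
rewrite ler_expR; set s := t / (4 * m); set mu := q * _.
have s0 : 0 < s by rewrite divr_gt0 ?mulr_gt0.
have cm : #|star v|%:R <= m by rewrite -mE ler_nat card_star_le.
have mu1 : mu <= q * m by rewrite ler_wpM2l// ltW.
have mu2 : mu <= m by apply: le_trans mu1 _; rewrite ler_piMl// ltW.
clearbody mu; apply: le_trans (_ : s * (- t) + 2 * s ^+ 2 * m <= _).
  by apply: lerD; [rewrite ler_wpM2l ?(ltW s0)// yE; move: mu1; lra|rewrite ler_wpM2l// mulr_ge0 ?sqr_ge0].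
by rewrite le_eqVlt; apply/orP; left; apply/eqP; rewrite /s; field; rewrite gt_eqF.
Qed.

End Null.

Section Planted.
Variables (G : sgraph) (f : G -> 'I_n) (u : G) (D t : R).
Hypotheses (fI : injective f) (uA : f u \in A)
  (uD : D <= #|(f @: neighbors u) :&: M|%:R) (t0 : 0 < t) (tm : t <= 2 * m)
  (yE : y + t <= q * (m - 1) + (1 - q) * D).

(** Lower tail with s = - t / (4 m), for the star of one center lying in [A]: each of its leaves in
    [M] raises a probability from q to 1. *)
Lemma scan_planted :
  \sum_x wt (on star_query (eprob q (emb f))) x * (~~ scan x)%:R <=
  expR (- (t ^+ 2 / (8 * m))).
Proof.
have /andP[q0 q1] := q01; have m0 : 0 < m by move: t0 tm; lra.
set a := on _ _; pose s := - (t / (4 * m)).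
have tm0 : 0 < t / (4 * m) by rewrite divr_gt0 ?mulr_gt0.
apply: le_trans (_ : \sum_(x | s * y <= s * #|x :&: star (f u)|%:R) wt a x <= _).
  rewrite [leRHS]big_mkcond; apply: ler_sum => x _.
  have w0 : 0 <= wt a x by apply: wt_ge0 => e; exact: on_eprob01.
  case: (boolP (scan x)) => [_|]; first by rewrite mulr0; case: ifP.
  rewrite negb_exists => /forallP/(_ (f u)); rewrite uA /= -ltNge => yx.
  by rewrite mulr1 ifT// ler_wnM2l ?oppr_le0 ?ltW.
apply: le_trans (wt_tail (star (f u)) y (on_eprob01 q01 _ _) _) _.
  by apply: le_trans (_ : 0 <= _); rewrite ?oppr_le0 ?invr_ge0// ltW.
set mu := \sum_(e in _) _.
have aE e : e \in star (f u) -> a e = if e \in emb f then 1 else q.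
  by move=> eu; rewrite /a /on (star_sub uA eu) /eprob (subsetP star_query_sub) ?(star_sub uA eu).
have mu1 : mu <= m.
  apply: le_trans (_ : #|star (f u)|%:R <= _); last by rewrite -mE ler_nat card_star_le.
  rewrite -sumr_const; apply: ler_sum => e _.
  by have /andP[] := on_eprob01 q01 star_query (emb f) e.
have mu2 : q * (m - 1) + (1 - q) * D <= mu.
  have -> : mu = \sum_(x in M :\ f u) (if [set f u; x] \in emb f then 1 else q).
    rewrite /mu big_imset /=; last exact: star_inj.
    by apply: eq_bigr => x xM; rewrite -aE//; exact: imset_f.
  apply: le_trans (_ : \sum_(x in M :\ f u) (q + (1 - q) * (x \in f @: neighbors u)%:R) <= _).
    rewrite big_split /= -mulr_sumr sumr_const; apply: lerD.
      rewrite -(mulr_natr q) ler_wpM2l ?(ltW q0)// lerBlDr.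
      by rewrite -mE (cardsD1 (f u)) addrC natrD lerD2r lern1 leq_b1.
    rewrite ler_wpM2l ?subr_ge0 ?(ltW q1)//; apply: le_trans uD _.
    rewrite -sum1_card natr_sum big_mkcond [leRHS]big_mkcond.
    apply: ler_sum => x _; rewrite !inE.
    case: imsetP => [[w uw ->]|_] /=; last by case: ifP.
    rewrite (inj_eq fI); have -> : w != u.
      by apply: contraTneq uw => ->; rewrite inE adj_irr.
    by case: ifP.
  apply: ler_sum => x xM; case: imsetP => [[w uw ->]|_]; last first.
    by rewrite mulr0 addr0; case: ifP => // _; exact: ltW.
  rewrite ifT ?mulr1 ?subrKC//; apply/embP; exists u, w; split=> //.
  by rewrite inE in uw.
rewrite ler_expR sqrrN /s; set r := t / (4 * m) in tm0 *.
apply: le_trans (_ : r * (- t) + 2 * r ^+ 2 * m <= _).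
  apply: lerD; last by rewrite ler_wpM2l// mulr_ge0 ?sqr_ge0.
  by rewrite mulNr -mulrN ler_wpM2l ?(ltW tm0)//; move: mu2 yE; lra.
by rewrite le_eqVlt; apply/orP; left; apply/eqP; rewrite /r; field; rewrite gt_eqF.
Qed.

End Planted.

Section Power.
Variables (G : sgraph) (B : {set G}) (d : nat) (t D delta : R).
Hypotheses (Gn : (#|G| <= n)%N) (Bdeg : forall u, u \in B -> (d <= deg u)%N)
  (B0 : (0 < #|B|)%N) (d0 : (0 < d)%N) (t0 : 0 < t) (tm : t <= 2 * m)
  (DE : D = d%:R * m / n%:R / 2)
  (yE : y + t <= q * (m - 1) + (1 - q) * D)
  (delta0 : 0 < delta) (Adelta : A = setT \/ delta <= #|A|%:R * #|B|%:R / n%:R).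

(** The three terms bound a deviation of the edge noise, the absence of [B] from [A], and a shortage
    of leaves in [M] for some center. The shortage is excluded for all of [B] at once, since the
    center that falls into [A] depends on the permutation. If [A] is everything, absence is
    impossible. *)
Lemma scan_power :
  \sum_x transcript_law (law_H1 q G) star_query x * (~~ scan x)%:R <=
  expR (- (t ^+ 2 / (8 * m))) + 4 / delta + 4 * #|B|%:R * n%:R / (d%:R * m).
Proof.
have /andP[q0 q1] := q01; have m0 : 0 < m by move: t0 tm; lra.
have c0 := copies_gt0 Gn.
have n0 : (0 < n)%N by rewrite (leq_trans _ Gn)// (leq_trans B0)// max_card.
set rhs := _ + _ + _.
have tot (F : pairset n) :
    \sum_x wt (on star_query (eprob q F)) x * (~~ scan x)%:R <= 1.
  rewrite -[leRHS](wt_sum1 (on star_query (eprob q F))); apply: ler_sum => x _.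
  apply: ler_piMr; last by rewrite lern1 leq_b1.
  by apply: wt_ge0 => e; exact: on_eprob01.
have key (f : G -> 'I_n) : injective f ->
    mean setT (fun s : {perm 'I_n} =>
      \sum_x wt (on star_query (eprob q (emb (s \o f)))) x * (~~ scan x)%:R) <= rhs.
  move=> fI.
  pose miss (s : {perm 'I_n}) := [forall u in B, s (f u) \notin A].
  pose few (s : {perm 'I_n}) u := #|(s @: (f @: neighbors u)) :&: M|%:R < D.
  apply: le_trans (_ : mean setT (fun s : {perm 'I_n} => expR (- (t ^+ 2 / (8 * m))) +
     (miss s)%:R + \sum_(u in B) (few s u)%:R) <= _).
    apply: mean_le => s _.
    have e0 := expR_ge0 (- (t ^+ 2 / (8 * m))).
    have s0 : 0 <= \sum_(u in B) (few s u)%:R :> R by rewrite sumr_ge0.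
    have [ms|/forallPn[u]] := boolP (miss s).
      by apply: le_trans (tot _) _; rewrite -addrA addrCA lerDl addr_ge0.
    rewrite negb_imply negbK => /andP[uB uA].
    case: (boolP (few s u)) => [fu|].
      apply: le_trans (tot _) _; rewrite (bigD1 u) //= fu.
      by rewrite addr0 addrCA lerDl addr_ge0// sumr_ge0.
    rewrite /few -leNgt => uD; rewrite addr0; apply: le_trans (_ : expR (- (t ^+ 2 / (8 * m))) <= _).
      apply: (scan_planted (u := u) (D := D)) => //.
        by move=> v w /= /perm_inj /fI.
      by rewrite -imset_comp in uD.
    by rewrite lerDl.
  rewrite !meanD unif_cst mean_sum /rhs; apply: lerD; first apply: lerD => //.
    case: Adelta => [AT|Ad].
      apply: le_trans (_ : 0 <= _); last by rewrite divr_ge0 ?ltW.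
      apply: mean_le_cst => // s _; have /card_gt0P[u uB] := B0.
      by rewrite /miss (_ : [forall u in B, _] = false)//; apply/negbTE/forallPn; exists u; rewrite uB AT inE.
    have fB : #|f @: B| = #|B| by rewrite card_imset.
    have mu0 : 0 < #|A|%:R * #|f @: B|%:R / #|'I_n|%:R :> R.
      by rewrite fB card_ord; exact: lt_le_trans delta0 Ad.
    apply: le_trans (_ : 4 / (#|A|%:R * #|f @: B|%:R / #|'I_n|%:R) <= _).
      apply: le_trans (unif_chebyshev mu0); apply: mean_le => s _.
      rewrite ler_nat; case: (boolP (miss s)) => // /forall_inP ms.
      have -> : (s @: (f @: B)) :&: A = set0.
        apply/setP => z; rewrite !inE; apply/andP => -[/imsetP[_ /imsetP[u uB ->] ->]].
        exact/negP/ms.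
      by rewrite cards0 (divr_gt0 mu0).
    move: mu0; rewrite fB card_ord => mu0; apply: ler_wpM2l => //.
    by rewrite lef_pV2 ?posrE.
  have -> : 4 * #|B|%:R * n%:R / (d%:R * m) = \sum_(u in B) (4 * (n%:R / (d%:R * m))).
    by rewrite sumr_const -(mulr_natl (4 * _)) mulrA [_ * 4]mulrC !mulrA.
  apply: ler_sum => u uB.
  have fN : #|f @: neighbors u| = deg u by rewrite card_imset.
  have dn : 0 < d%:R * m / n%:R by rewrite divr_gt0 ?mulr_gt0 ?ltr0n.
  have dd : d%:R * m / n%:R <= #|M|%:R * #|f @: neighbors u|%:R / #|'I_n|%:R.
    rewrite fN card_ord mE ler_wpM2r ?invr_ge0// mulrC ler_wpM2l ?(ltW m0)//.
    by rewrite ler_nat Bdeg.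
  have mu0 := lt_le_trans dn dd.
  apply: le_trans (_ : 4 / (#|M|%:R * #|f @: neighbors u|%:R / #|'I_n|%:R) <= _).
    apply: le_trans (unif_chebyshev mu0); apply: mean_le => s _.
    rewrite ler_nat /few; case: (boolP (_ < D)) => // fs.
    by rewrite (lt_le_trans fs)// DE ler_wpM2r ?invr_ge0.
  rewrite -[n%:R / _]invf_div ler_wpM2l// lef_pV2 ?posrE//.
have -> : \sum_x transcript_law (law_H1 q G) star_query x * (~~ scan x)%:R =
    mean (copies G n) (fun H => mean setT (fun s : {perm 'I_n} =>
      \sum_x wt (on star_query (eprob q (img s H.2))) x * (~~ scan x)%:R)).
  under [RHS]eq_mean => H _ do rewrite mean_sum.
  rewrite mean_sum; apply: eq_bigr => x _; rewrite /transcript_law.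
  under eq_bigr => E _ do rewrite law_H1_mean.
  rewrite -mean_sum mulrC -meanZ; apply: eq_mean => H /copies_emb[f fI ->].
  rewrite -mean_sum -meanZ; apply: eq_mean => s _; rewrite mulrC -transcript_forced//.
  by rewrite img_emb; apply: emb_sub => u v /perm_inj /fI.
apply: mean_le_cst => [|H /copies_emb[f fI ->]].
  by rewrite /rhs !addr_ge0 ?expR_ge0 ?divr_ge0 ?mulr_ge0 ?(ltW delta0) ?(ltW m0).
apply: le_trans (key f fI); apply: mean_le => s _.
by rewrite img_emb.
Qed.

End Power.
End UpperBound.

(** * Comparison of the bounds and impossibility *)

Section Comparison.
Variables (R : realType) (n : nat) (G : sgraph) (U : {set G}).
Hypotheses (Gn : (#|G| <= n)%N) (n1 : (1 <= n)%N) (isoG : no_isolated G)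
  (covU : vertex_cover U) (indU : edgeless_on U) (uniqU : unique_cover_neighbor U).

Lemma ln2_gt0 : 0 < ln 2 :> R.
Proof. by rewrite ln_gt0// ltr1n. Qed.

(** Without edges both bounds are 0 by the convention for division by 0; in the other case [2 <= n]
    makes ln n at least ln 2. *)
Lemma empty_or_large :
  (S2 U = 0 /\ kappa G = 0)%N \/ [/\ (0 < S2 U)%N, (0 < kappa G)%N & (2 <= n)%N].
Proof.
have kS := kappa_le_2S2 isoG covU indU uniqU.
have [S0|S0] := posnP (S2 U); first by left; split=> //; lia.
right; split=> //.
  by have := S2_le isoG indU; case: (kappa G) S0 => //; rewrite muln0; lia.
have [U0|[u _]] := set_0Vmem U; first by rewrite /S2 U0 big_set0 in S0.
have [w uw] := isoG u.
apply: leq_trans Gn; rewrite -cardsT; apply: leq_trans (subset_leq_card (subsetT (u |: [set w]%SET)%SET)).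
by rewrite cards2; case: (eqVneq u w) uw => // ->; rewrite adj_irr.
Qed.

Lemma upper_bound_ge0 : 0 <= upper_bound R n G.
Proof. by rewrite /upper_bound mulr_ge0 ?sqr_ge0// divr_ge0 ?exprn_ge0. Qed.

Lemma lower_bound_ge0 : 0 <= lower_bound R n U.
Proof. by rewrite /lower_bound divr_ge0 ?exprn_ge0. Qed.

(** The 2 comes from [kappa_le_2S2], and ln 2 from comparing the squared logarithm with its value at
    2. *)
Lemma lower_le_upper : lower_bound R n U <= 2 / ln 2 ^+ 2 * upper_bound R n G.
Proof.
have l2 := ln2_gt0; have l22 : 0 < ln 2 ^+ 2 :> R by rewrite exprn_gt0.
case: empty_or_large => [[S0 _]|[S0 k0 n2]].
  rewrite /lower_bound S0 invr0 mulr0 mulr_ge0 ?upper_bound_ge0// divr_ge0 ?sqr_ge0//.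
rewrite /lower_bound /upper_bound.
have n30 : 0 < n%:R ^+ 3 :> R by rewrite exprn_gt0 ?ltr0n.
have h1 : n%:R ^+ 3 / (S2 U)%:R <= 2 * (n%:R ^+ 3 / (kappa G)%:R) :> R.
  rewrite mulrCA ler_wpM2l ?(ltW n30)// ler_pdivlMr ?ltr0n// mulrC ler_pdivrMr ?ltr0n//.
  by rewrite -natrM ler_nat; exact: kappa_le_2S2.
apply: le_trans h1 _; set x := _ / _.
have x0 : 0 <= x by rewrite divr_ge0 ?(ltW n30).
have -> : 2 / ln 2 ^+ 2 * (x * ln n%:R ^+ 2) = 2 * (x * (ln n%:R ^+ 2 / ln 2 ^+ 2)).
  by field; rewrite gt_eqF.
rewrite ler_wpM2l// ler_peMr// ler_pdivlMr// mul1r.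
have ln2n : ln 2 <= ln n%:R :> R by rewrite ler_ln ?posrE ?ltr0n// ler_nat.
by rewrite lerXn2r ?nnegrE ?(ltW l2)// (le_trans (ltW l2)).
Qed.

Lemma upper_le_lower (c : R) : 0 <= c -> (S2 U)%:R <= c * (kappa G)%:R ->
  upper_bound R n G <= c * ln n%:R ^+ 2 * lower_bound R n U.
Proof.
move=> c0 Sk; case: empty_or_large => [[S0 k0]|[S0 k0 n2]].
  rewrite /upper_bound k0 invr0 mulr0 mul0r mulr_ge0 ?lower_bound_ge0//.
  by rewrite mulr_ge0 ?sqr_ge0.
rewrite /lower_bound /upper_bound mulrC [leRHS]mulrAC [leRHS]mulrC ler_wpM2l ?sqr_ge0//.
rewrite mulrCA ler_wpM2l ?exprn_ge0// ler_pdivlMr ?ltr0n//.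
by rewrite mulrC ler_pdivrMr ?ltr0n.
Qed.

(** The maximum with 1 is needed when [Delta U] is 1, where the logarithm vanishes but the left side
    does not. *)
Lemma log2_bound : 4 * (1 + (trunc_log 2 (Delta U))%:R) <=
  4 * (1 + (ln 2)^-1) * Num.max 1 (ln (Delta U)%:R) :> R.
Proof.
have l2 := ln2_gt0; set M := Num.max _ _; rewrite -mulrA ler_wpM2l//.
have M1 : 1 <= M by rewrite le_max lexx.
rewrite mulrDl mul1r lerD//; rewrite mulrC ler_pdivlMr//.
have [->|D0] := posnP (Delta U); first by rewrite trunc_log0 mul0r (le_trans ler01).
apply: le_trans (_ : ln (Delta U)%:R <= _); last by rewrite le_max lexx orbT.
rewrite mulr_natl -lnXn// ler_ln ?posrE ?exprn_gt0 ?ltr0n//.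
by rewrite -natrX ler_nat trunc_logP.
Qed.

End Comparison.

Section Main.
Variables (R : realType) (q : R).
Hypothesis q01 : 0 < q < 1.

Lemma weak_detection_bound (Gam : nat -> sgraph) (U : forall n, {set Gam n})
  (Qn : nat -> nat) :
  star_family U -> budget_below R U Qn -> weak_detection_impossible q Gam Qn.
Proof.
move=> star bud; apply/cvgrPdist_le => eps e0.
have e20 : 0 < 2 * eps by rewrite mulr_gt0.
have /andP[q0 q1] := q01.
(* [detection_dTV] is used with parameter 2 eps, so its first term is eps / 2. [K] is the factor of
   Q_n S_2 / n^3 in the other term, which the budget brings below eps / 2. *)
pose K := (2 + (2 * (2 * eps))^-1) * ((q^-1 - 1) * (8 * expR 1 ^+ 2)).
have K0 : 0 <= K.
  rewrite /K mulr_ge0 ?addr_ge0 ?invr_ge0 ?mulr_ge0 ?(ltW e0) ?exprn_ge0 ?expR_ge0//.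
  by rewrite subr_ge0 ltW// invf_gt1.
have K1 : 0 < K + 1 by rewrite ltr_wpDl.
have h : \forall n \near \oo,
    `|(Qn n)%:R / lower_bound R n (U n)| <= eps / (2 * (K + 1)).
  by move/cvgr0_norm_le: bud; apply; rewrite divr_gt0 ?mulr_gt0.
near=> n.
have n1 : (1 <= n)%N by near: n; exact: nbhs_infty_ge.
have [Gn iso cov ind uni] := star n n1.
have bn : (Qn n)%:R / lower_bound R n (U n) <= eps / (2 * (K + 1)).
  by apply: le_trans (ler_norm _) _; near: n.
rewrite /opt_risk opprB addrC subrK.
have max0 : 0 <= \big[Num.max/0]_(Q | admissible (Qn n) Q)
    dTV (transcript_law (law_H1 q (Gam n)) Q) (transcript_law (@law_H0 R q n) Q).
  by elim/big_rec: _ => // Q x _ x0; rewrite le_max x0 orbT.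
rewrite ger0_norm//; apply: bigmax_le => [|Q /andP[QP Qb]]; first exact: ltW.
apply: le_trans (detection_dTV q01 iso cov ind uni Gn QP Qb e20) _.
set b0 := (Qn n)%:R / _ in bn.
have -> : (2 + (2 * (2 * eps))^-1) * ((q^-1 - 1) *
    (8 * expR 1 ^+ 2 * (S2 (U n))%:R * (Qn n)%:R / n%:R ^+ 3)) = K * b0.
  rewrite /K /b0 /lower_bound invf_div; ring.
have Kb : K * b0 <= eps / 2.
  apply: le_trans (ler_wpM2l K0 bn) _.
  rewrite mulrA ler_pdivrMr ?mulr_gt0//.
  have -> : eps / 2 * (2 * (K + 1)) = K * eps + eps by field.
  by rewrite lerDl ltW.
lra.
Unshelve. all: by end_near. Qed.

End Main.

(** * Detection *)

Section Level.
Variables (R : realType) (C1 : R) (n d : nat) (G : sgraph).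
Hypotheses (C1_ge1 : 1 <= C1) (n3 : 1 <= ln n%:R :> R) (dmax : maximizing_level G d)
  (mn : (level_size C1 n d)%:~R <= n%:R / 2 :> R).

Let x : R := C1 * (n%:R ^+ 2 / d%:R ^+ 2) * ln n%:R.

Lemma ln_ge1_gt1 : (1 < n)%N.
Proof.
case: n n3 => [|[|k]] //; first by rewrite ln0// ler10.
by rewrite ln1 ler10.
Qed.

Lemma level_size_ge : x <= (level_size C1 n d)%:~R.
Proof. exact: ceil_ge. Qed.

(** At level 1 the set [M] would need at least C1 n^2 ln n > n / 2 points, against feasibility. *)
Lemma level_ge2 : (2 <= d)%N.
Proof.
have n1 := ln_ge1_gt1; have [d1 _] := dmax.
rewrite ltnNge; apply/negP => d_le1; have d_eq1 : d = 1%N by lia.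
have := le_trans level_size_ge mn; rewrite /x d_eq1 expr1n divr1 => h.
have n0 : 0 < n%:R :> R by rewrite ltr0n ltnW.
have : 1 * n%:R ^+ 2 * 1 <= C1 * n%:R ^+ 2 * ln n%:R by rewrite ler_pM ?ler_wpM2r ?mulr_ge0 ?exprn_ge0.
move=> /le_trans /(_ h); have : (2 <= n%:R :> R) by rewrite ler_nat.
by nra.
Qed.

End Level.

Section Detection.
Variables (R : realType) (q : R).
Hypothesis q01 : 0 < q < 1.

Lemma card_ord_lt (n a : nat) : (a <= n)%N -> #|[set i : 'I_n | (i < a)%N]%SET| = a.
Proof.
move=> an; have wI : injective (widen_ord an) by move=> i j /(congr1 val) /= /val_inj.
rewrite -[RHS]card_ord -(card_imset _ wI).
apply: eq_card => i; rewrite inE; apply/idP/imsetP => [ia|[j _ ->]]; last exact: (ltn_ord j).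
by exists (Ordinal ia) => //; apply: val_inj.
Qed.

Lemma ceil_nat (x : R) : 0 <= x -> exists k : nat, [/\ x <= k%:R, k%:R <= x + 1 &
  (Num.ceil x)%:~R = k%:R :> R].
Proof.
move=> x0; exists `|Num.ceil x|%N.
have c0 : 0 <= Num.ceil x by rewrite ceil_ge0 (lt_le_trans _ x0)// ltrN10.
have -> : `|Num.ceil x|%:R = (Num.ceil x)%:~R :> R by rewrite -[in RHS](gez0_abs c0).
split=> //; first exact: ceil_ge.
have := ceilB1_lt x; rewrite intrB => /ltW; lra.
Qed.

(** With k = m_d, L = ln n and z = d m / n, take |A| = min(n, ceil(n L / k)), |M| = m and threshold
    q m + t, where t = (1 - q) z / 4. *)
Lemma scan_detects (C1 : R) (n d : nat) (G : sgraph) (U : {set G}) (b : nat) :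
  no_isolated G -> vertex_cover U -> edgeless_on U -> unique_cover_neighbor U ->
  (#|G| <= n)%N -> 32 ^+ 2 / (1 - q) ^+ 2 <= C1 -> 1 <= ln n%:R :> R ->
  maximizing_level G d -> (level_size C1 n d)%:~R <= n%:R / 2 :> R ->
  10 * ln n%:R <= #|G|%:R * (level_size C1 n d)%:~R / n%:R :> R ->
  4 * C1 * upper_bound R n G <= b%:R ->
  exists (A M : {set 'I_n}) (y : R),
    [/\ admissible b (star_query A M),
        \sum_x transcript_law (@law_H0 R q n) (star_query A M) x * (scan A M y x)%:R <=
          1 / ln n%:R &
        \sum_x transcript_law (law_H1 q G) (star_query A M) x * (~~ scan A M y x)%:R <=
          9 / ln n%:R].
Proof.
move=> iso cov ind uni Gn C1q L1 dmax mn hG hb.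
have /andP[q0 q1] := q01; have p0 : 0 < 1 - q by rewrite subr_gt0.
have p1 : 1 - q <= 1 by rewrite gerBl ltW.
have C1024 : 32 ^+ 2 <= C1 * (1 - q) ^+ 2 by rewrite -ler_pdivrMr ?exprn_gt0.
have C0 : 0 <= C1.
  by apply: le_trans C1q; apply: divr_ge0; exact: sqr_ge0.
have C1p : 32 ^+ 2 <= C1 * (1 - q).
  by apply: le_trans C1024 _; rewrite ler_wpM2l// expr2 ler_piMl// ltW.
have C1_1 : 1 <= C1.
  have : C1 * (1 - q) <= C1 * 1 by rewrite ler_wpM2l.
  lra.
set L := ln n%:R in L1 hG hb *; have L0 : 0 < L by lra.
have n1 : (1 < n)%N := ln_ge1_gt1 L1.
have nR : 0 < n%:R :> R by rewrite ltr0n ltnW.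
have d2 := level_ge2 C1_1 L1 dmax mn; have [d1 dk] := dmax.
have dR : 0 < d%:R :> R by rewrite ltr0n.
pose x : R := C1 * (n%:R ^+ 2 / d%:R ^+ 2) * L.
have x0 : 0 <= x by rewrite !mulr_ge0 ?invr_ge0 ?exprn_ge0//; lra.
have [m [xm mx mE]] := ceil_nat x0.
rewrite /level_size -/L -/x mE in mn hG.
pose B := [set u : G | (d <= deg u)%N]%SET.
have G0 : (0 < #|G|)%N.
  rewrite lt0n; apply: contraTneq hG => ->; rewrite !mul0r -ltNge; lra.
have k0 : (0 < #|B|)%N.
  have : (0 < kappa G)%N by apply: leq_trans (kappa_ge G 1); rewrite (mdeg1 iso) muln1.
  by rewrite -dk muln_gt0 => /andP[].
have kd : (#|B| * d <= n)%N.
  apply: leq_trans Gn; rewrite -sum_nat_const.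
  apply: leq_trans (_ : \sum_(u in B) deg u <= _)%N.
    by apply: leq_sum => u; rewrite inE.
  by apply: leq_trans (sum_deg_cover ind uni (high_deg_cover cov uni d2)) (max_card _).
have kR : 0 < #|B|%:R :> R by rewrite ltr0n.
have kdR : #|B|%:R * d%:R <= n%:R :> R by rewrite -natrM ler_nat.
have dn : d%:R <= n%:R :> R.
  by rewrite ler_nat (leq_trans _ kd)// leq_pmull.
have kn : #|B|%:R <= n%:R :> R.
  by rewrite ler_nat (leq_trans _ kd)// leq_pmulr.
(* Since [x] and n L / k are at least 1, rounding up at most doubles each; this is the factor 4 in
   the budget. *)
have x1 : 1 <= x.
  rewrite /x mulr_ege1// mulr_ege1// ler_pdivlMr ?exprn_gt0// mul1r.
  by rewrite lerXn2r ?nnegrE.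
have mR : 0 < m%:R :> R by lra.
have mnN : (m <= n)%N.
  rewrite -(ler_nat R); apply: le_trans mn _; rewrite ler_pdivrMr//; lra.
(* the expected number of planted edges between a center and M *)
pose z := d%:R * m%:R / n%:R : R.
have z0 : 0 < z by rewrite divr_gt0 ?mulr_gt0.
have zx : C1 * L * n%:R / d%:R <= z.
  apply: le_trans (_ : d%:R * x / n%:R <= _); last first.
    by rewrite ler_wpM2r ?invr_ge0 ?(ltW nR)// ler_wpM2l ?(ltW dR).
  by rewrite le_eqVlt; apply/orP; left; apply/eqP; rewrite /x; field; rewrite !gt_eqF.
have zC : C1 * L <= z.
  apply: le_trans zx; rewrite -mulrA ler_peMr ?mulr_ge0 ?(le_trans _ C1_1) ?(ltW L0)//.
  by rewrite ler_pdivlMr// mul1r.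
have z2 : C1 * L <= z ^+ 2 / m%:R.
  have -> : z ^+ 2 / m%:R = d%:R ^+ 2 * m%:R / n%:R ^+ 2.
    by rewrite /z; field; rewrite !gt_eqF.
  rewrite ler_pdivlMr ?exprn_gt0//; apply: le_trans (_ : d%:R ^+ 2 * x <= _).
    by rewrite le_eqVlt; apply/orP; left; apply/eqP; rewrite /x; field; rewrite !gt_eqF.
  by rewrite ler_wpM2l ?exprn_ge0.
(* Half of the expected leaves raise the mean by (1 - q) z / 2 = 2 t. The threshold takes t, the
   lower tail t / 2, and the remaining t / 2 >= 1 pays for the pair lost when the center lies in
   [M]. *)
pose t := (1 - q) * z / 4.
have t2 : 2 <= t.
  have : C1 * L * (1 - q) <= z * (1 - q) by rewrite ler_wpM2r// ltW.
  have := ler_wpM2r (ltW L0) C1p.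
  rewrite /t; lra.
have zm : z <= m%:R by rewrite /z ler_pdivrMr// mulrC ler_wpM2l// ltW.
have tm : t <= m%:R.
  have : (1 - q) * z <= 1 * z by rewrite ler_wpM2r// ltW.
  rewrite /t; lra.
(* The left-hand constant fixes C1: the right side is (1 - q)^2 z^2 / (512 m), with z^2 / m >= C1 L
   and C1 (1 - q)^2 >= 1024. *)
have tail : 2 * L <= (t / 2) ^+ 2 / (8 * m%:R).
  have -> : (t / 2) ^+ 2 / (8 * m%:R) = (1 - q) ^+ 2 * (z ^+ 2 / m%:R) / (2 * 16 ^+ 2).
    by rewrite /t; field; rewrite gt_eqF.
  have h1 := ler_wpM2l (sqr_ge0 (1 - q)) z2.
  have h2 := ler_wpM2r (ltW L0) C1024.
  rewrite ler_pdivlMr; last by rewrite mulr_gt0 ?exprn_gt0 ?ltr0n.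
  apply: le_trans _ h1; rewrite [leRHS]mulrCA [leRHS]mulrA; apply: le_trans _ h2; lra.
have r0 : 0 <= n%:R * L / #|B|%:R by rewrite !mulr_ge0 ?invr_ge0 ?(ltW L0).
have [a0 [ra0 a0r _]] := ceil_nat r0.
pose a := minn n a0.
pose A := [set i : 'I_n | (i < a)%N]%SET; pose M := [set i : 'I_n | (i < m)%N]%SET.
have cA : #|A| = a by rewrite card_ord_lt// geq_minl.
have cM : #|M| = m by rewrite card_ord_lt.
have cMR : #|M|%:R = m%:R :> R by rewrite cM.
have eL : expR (- (2 * L)) <= 1 / L.
  rewrite expRN div1r lef_pV2 ?posrE ?expR_gt0//.
  apply: le_trans _ (expR_ge1Dx (2 * L)); lra.
exists A, M, (q * m%:R + t); split.
- rewrite /admissible star_query_sub/= (leq_trans (card_star_query _ _))//.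
  rewrite cA cM -(ler_nat R) natrM; apply: le_trans _ hb.
  apply: le_trans (_ : (2 * (n%:R * L / #|B|%:R)) * (2 * x) <= _).
    rewrite ler_pM//.
      apply: le_trans (_ : a0%:R <= _); first by rewrite ler_nat geq_minr.
      apply: le_trans a0r _.
      have : 1 <= n%:R * L / #|B|%:R.
        rewrite ler_pdivlMr// mul1r; apply: le_trans kn _.
        by rewrite ler_peMr ?(ltW nR).
      lra.
    lra.
  rewrite /upper_bound -/L -dk natrM natrX /x.
  by rewrite le_eqVlt; apply/orP; left; apply/eqP; field; rewrite !gt_eqF.
- have t0 : 0 < t by lra.
  have tm2 : t <= 2 * m%:R by lra.
  have null := @scan_null R q n A M (q * m%:R + t) q01 m%:R cMR t t0 tm2 erefl.
  apply: le_trans null _.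
  (* The null deviation is t instead of t / 2, so the exponent is four times larger and absorbs the
     union bound over at most n = e^L vertices. *)
  have h : 7 * L <= t ^+ 2 / (8 * m%:R).
    have -> : t ^+ 2 / (8 * m%:R) = 4 * ((t / 2) ^+ 2 / (8 * m%:R)).
      by field; rewrite gt_eqF.
    lra.
  apply: le_trans (_ : expR L * expR (- (5 * L)) <= _).
    rewrite ler_pM ?expR_ge0//; first by rewrite cA /L lnK ?posrE// ler_nat geq_minl.
    rewrite ler_expR; lra.
  by rewrite -expRD; apply: le_trans _ eL; rewrite ler_expR; lra.
- have := @scan_power R q n A M (q * m%:R + t) q01 m%:R cMR G B d (t / 2) (z / 2) L Gn.
  move=> /(_ _ k0 d1) H; apply: le_trans (H _ _ _ _ _ L0 _) _ => {H}.
  + by move=> u; rewrite inE.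
  + lra.
  + lra.
  + by [].
  + rewrite mulrBr mulr1 mulrA; rewrite /t in t2 *; lra.
  + rewrite cA /a; have [na|na] := leqP n a0; [left|right].
      by apply/setP => i; rewrite !inE /a (minn_idPl na) ltn_ord.
    by rewrite ler_pdivlMr// mulrC -ler_pdivrMr// mulrC mulrA mulrC [L * _]mulrC.
  apply: le_trans (_ : 1 / L + 4 / L + 4 / L <= _); last by rewrite -!mulrDl; lra.
  apply: lerD; first apply: lerD => //.
    by apply: le_trans _ eL; rewrite ler_expR lerN2.
  (* Here k d <= n enters: z >= C1 L n / d >= L k. *)
  have -> : 4 * #|B|%:R * n%:R / (d%:R * m%:R) = 4 * (#|B|%:R / z).
    by rewrite /z; field; rewrite !gt_eqF.
  rewrite ler_wpM2l// ler_pdivrMr// mulrC ler_pdivlMr//.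
  apply: le_trans _ zx; rewrite ler_pdivlMr//.
  apply: le_trans (_ : 1 * L * n%:R <= _); last by rewrite !ler_wpM2r ?(ltW nR) ?(ltW L0).
  by rewrite mul1r mulrAC mulrC ler_wpM2l ?(ltW L0).
Qed.

End Detection.

(** * From the scan at one n to a sequence of tests *)

Section StrongDetection.
Variables (R : realType) (q : R).
Hypothesis q01 : 0 < q < 1.

Lemma forced_law_ge0 n (F E : pairset n) : 0 <= forced_law q F E.
Proof.
have /andP[q0 q1] := q01; rewrite /forced_law; case: ifP => // _.
by apply: prodr_ge0 => e _; case: ifP => _; rewrite ?subr_ge0 ltW.
Qed.

Lemma type_I_ge0 n (mu : pairset n -> R) phi :
  (forall Q, 0 <= mu Q) -> random_test phi -> 0 <= type_I q mu phi.
Proof.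
move=> mu0 phi01; apply: sumr_ge0 => Q _; apply: mulr_ge0 => //.
apply: sumr_ge0 => x _; apply: mulr_ge0; last by have /andP[] := phi01 Q x.
by apply: sumr_ge0 => E _; exact: forced_law_ge0.
Qed.

Lemma type_II_ge0 n (G : sgraph) (mu : pairset n -> R) phi :
  (forall Q, 0 <= mu Q) -> random_test phi -> 0 <= type_II q G mu phi.
Proof.
move=> mu0 phi01; apply: sumr_ge0 => Q _; apply: mulr_ge0 => //.
apply: sumr_ge0 => x _; apply: mulr_ge0; last by have /andP[] := phi01 Q x; rewrite subr_ge0.
apply: sumr_ge0 => E _; apply: mulr_ge0; first by rewrite invr_ge0.
by apply: sumr_ge0 => H _; exact: forced_law_ge0.
Qed.

Definition point_query n (Q0 Q : pairset n) : R := (Q == Q0)%:R.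

Lemma point_query_sum n (Q0 : pairset n) (f : pairset n -> R) :
  \sum_Q point_query Q0 Q * f Q = f Q0.
Proof.
rewrite (bigD1 Q0) //= big1 ?addr0; first by rewrite /point_query eqxx mul1r.
by move=> Q /negPf QQ0; rewrite /point_query QQ0 mul0r.
Qed.

Lemma point_query_random n b (Q0 : pairset n) :
  admissible b Q0 -> random_query b (point_query Q0).
Proof.
move=> adm; split=> [Q||Q]; first exact: ler0n.
  by rewrite -[RHS](point_query_sum Q0 (fun=> 1)); apply: eq_bigr => Q _; rewrite mulr1.
by rewrite /point_query; case: (eqVneq Q Q0) => [->|_] //=; rewrite eqxx.
Qed.

Lemma empty_admissible n b : admissible b (finset.set0 : pairset n).
Proof. by rewrite /admissible sub0set cards0. Qed.

(** Valid queries and tests are required for every n, but the hypotheses hold only eventually: where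
    they fail, nothing is queried and the null is always accepted. *)
Lemma strong_detection_from_level (C1 : R) (Gam : nat -> sgraph)
  (U : forall n, {set Gam n}) (Qn : nat -> nat) :
  star_family U -> 32 ^+ 2 / (1 - q) ^+ 2 <= C1 -> feasible C1 Gam ->
  budget_above (4 * C1) Gam Qn -> strong_detection q Gam Qn.
Proof.
move=> star C1q feas bud.
pose P n := [/\ (1 <= n)%N, 1 <= ln n%:R :> R, exists d : nat,
    [/\ maximizing_level (Gam n) d, (level_size C1 n d)%:~R <= n%:R / 2 :> R &
        10 * ln n%:R <= #|Gam n|%:R * (level_size C1 n d)%:~R / n%:R :> R] &
    4 * C1 * upper_bound R n (Gam n) <= (Qn n)%:R].
pose err n (s : (pairset n -> R) * (pairset n -> pairset n -> R)) :=
  type_I q s.1 s.2 + type_II q (Gam n) s.1 s.2.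
have H n : exists s : (pairset n -> R) * (pairset n -> pairset n -> R),
    [/\ random_query (Qn n) s.1, random_test s.2 & P n -> err n s <= 10 / ln n%:R].
  have [[n1 L1 [d [dmax mn hG]] hb]|nP] := pselect (P n); last first.
    exists (point_query finset.set0, fun _ _ => 0); split=> //=.
      exact/point_query_random/empty_admissible.
    by move=> Q x; rewrite lexx ler01.
  have [Gn iso cov ind uni] := star n n1.
  have [A [M [y [adm e1 e2]]]] := scan_detects q01 iso cov ind uni Gn C1q L1 dmax mn hG hb.
  exists (point_query (star_query A M), fun _ x => (scan A M y x)%:R); split=> /=.
  - exact: point_query_random.
  - by move=> Q x; case: (scan A M y x); rewrite /= ?lexx ler01.
  - move=> _; rewrite /err /type_I /type_II !point_query_sum /=.
    have -> : 10 / ln n%:R = 1 / ln n%:R + 9 / ln n%:R :> R by rewrite -mulrDl; congr (_ / _); lra.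
    apply: lerD => //; apply: le_trans _ e2; rewrite le_eqVlt; apply/orP; left; apply/eqP.
    by apply: eq_bigr => x _; case: (scan A M y x); rewrite /= ?subrr ?subr0.
pose s n := projT1 (cid (H n)).
have sP n : [/\ random_query (Qn n) (s n).1, random_test (s n).2 &
    P n -> err n (s n) <= 10 / ln n%:R] := projT2 (cid (H n)).
exists (fun n => (s n).1), (fun n => (s n).2); split.
  by move=> n _; have [] := sP n.
apply/cvgrPdist_le => eps e0; near=> n.
have [[mu0 _ _] phi01 errP] := sP n.
rewrite sub0r normrN ger0_norm; last by rewrite addr_ge0 ?type_I_ge0 ?type_II_ge0.
have n1 : (1 <= n)%N by near: n; exact: nbhs_infty_ge.
have nR : 0 < n%:R :> R by rewrite ltr0n.
(* This makes ln n at least 1 and 10 / ln n at most eps. *)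
have nL : expR (1 + 10 / eps) <= n%:R by near: n; exact: nbhs_infty_ger.
have L : 1 + 10 / eps <= ln n%:R by rewrite -[leLHS]expRK ler_ln ?posrE ?expR_gt0.
have e10 : 0 <= 10 / eps by rewrite divr_ge0// ltW.
have L1 : 1 <= ln n%:R :> R by lra.
apply: le_trans (errP _) _.
  by split=> //; [near: n; exact: feas|near: n; exact: bud].
rewrite ler_pdivrMr; last by lra.
rewrite mulrC -ler_pdivrMr//; lra.
Unshelve. all: by end_near. Qed.

End StrongDetection.

(** Feasibility excludes level 1 as a maximizer, and this is the only level at which leaves are
    counted. *)
Lemma kappa_le_S2_eventually (R : realType) (C1 : R) (Gam : nat -> sgraph)
  (U : forall n, {set Gam n}) :
  1 <= C1 -> star_family U -> feasible C1 Gam ->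
  \forall n \near \oo, (kappa (Gam n) <= S2 (U n))%N.
Proof.
move=> C11 star feas; near=> n.
have n1 : (1 <= n)%N by near: n; exact: nbhs_infty_ge.
have nL : expR 1 <= n%:R :> R by near: n; exact: nbhs_infty_ger.
have L1 : 1 <= ln n%:R :> R by rewrite -[leLHS]expRK ler_ln ?posrE ?expR_gt0// ltr0n.
have [d [dmax mn _]] : exists d : nat,
    [/\ maximizing_level (Gam n) d, (level_size C1 n d)%:~R <= n%:R / 2 :> R &
        10 * ln n%:R <= #|Gam n|%:R * (level_size C1 n d)%:~R / n%:R :> R].
  by near: n; exact: feas.
have [_ _ cov ind uni] := star n n1; have [_ <-] := dmax.
exact: mdeg_sqr_le cov ind uni _ (level_ge2 C11 L1 dmax mn).
Unshelve. all: by end_near. Qed.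

Theorem corollary2 (R : realType) (q : R) (hq : 0 < q < 1) :
  exists2 K : R, 0 < K &
  exists2 C10 : R, 0 < C10 & forall C1 : R, C10 <= C1 ->
  exists2 C : R, 0 < C &
  forall (Gam : nat -> sgraph) (U : forall n : nat, {set Gam n}),
  star_family U ->
  [/\ (* (i) *)
      forall Qn : nat -> nat,
        budget_below R U Qn -> weak_detection_impossible q Gam Qn,
      (* (ii) *)
      feasible C1 Gam ->
      forall Qn : nat -> nat,
        budget_above C Gam Qn -> strong_detection q Gam Qn,
      (* (iii) *)
      (forall n : nat, (1 <= n)%N ->
        [/\ (kappa (Gam n) <= 2 * S2 (U n))%N,
            (kappa (Gam n) <= S2 (U n))%N <-> (#|Gam n| <= S2 (U n))%N &
            (S2 (U n) <= 4 * (1 + trunc_log 2 (Delta (U n))) * kappa (Gam n))%N])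
      /\ (feasible C1 Gam ->
          \forall n \near \oo, (kappa (Gam n) <= S2 (U n))%N),
      (* comparison of the bounds *)
      forall n : nat, (1 <= n)%N ->
        lower_bound R n (U n) <= K * upper_bound R n (Gam n) /\
        upper_bound R n (Gam n) <=
          K * (Num.max 1 (ln (Delta (U n))%:R) * ln n%:R ^+ 2)
            * lower_bound R n (U n)
    & (* values dW u, u in U, of the same order *)
      forall c : R, exists2 K' : R, 0 < K' & forall n : nat, (1 <= n)%N ->
        (forall u v : Gam n, u \in U n -> v \in U n ->
          (dW (U n) u)%:R <= c * (dW (U n) v)%:R) ->
        lower_bound R n (U n) <= K' * upper_bound R n (Gam n) /\
        upper_bound R n (Gam n) <= K' * ln n%:R ^+ 2 * lower_bound R n (U n)].
Proof.
have /andP[q0 q1] := hq; have p0 : 0 < 1 - q by rewrite subr_gt0.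
have l2 := ln2_gt0 R; pose K0 : R := 2 / ln 2 ^+ 2; pose K1 : R := 4 * (1 + (ln 2)^-1).
have K00 : 0 < K0 by rewrite divr_gt0 ?exprn_gt0.
have K10 : 0 < K1 by rewrite mulr_gt0// addr_gt0 ?invr_gt0.
(* [K0] serves the comparison of the lower bound with the upper one, [K1] the converse; their sum
   serves both. *)
exists (K0 + K1); first exact: addr_gt0.
exists (32 ^+ 2 / (1 - q) ^+ 2); first by rewrite divr_gt0 ?exprn_gt0.
move=> C1 C1q.
have C11 : 1 <= C1.
  apply: le_trans _ C1q; rewrite ler_pdivlMr ?exprn_gt0// mul1r.
  by rewrite lerXn2r ?nnegrE ?(ltW p0)//; lra.
exists (4 * C1); first by lra.
move=> Gam U star; split.
- by move=> Qn bud; exact: (weak_detection_bound hq star bud).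
- move=> feas Qn bud; exact: (strong_detection_from_level hq star C1q feas bud).
- split; last by move=> feas; exact: (kappa_le_S2_eventually C11 star feas).
  move=> n n1; have [Gn iso cov ind uni] := star n n1; split.
  + exact: kappa_le_2S2.
  + exact: kappa_le_S2.
  + exact: S2_le.
- move=> n n1; have [Gn iso cov ind uni] := star n n1; split.
    apply: le_trans (lower_le_upper R Gn n1 iso cov ind uni) _.
    by rewrite ler_wpM2r ?upper_bound_ge0// lerDl ltW.
  set M := Num.max _ _; have M0 : 0 <= M by rewrite le_max ler01.
  apply: le_trans (upper_le_lower Gn n1 iso cov ind uni (c := K1 * M) _ _) _.
  + by rewrite mulr_ge0// ltW.
  + apply: le_trans (_ : (4 * (1 + (trunc_log 2 (Delta (U n)))%:R)) * (kappa (Gam n))%:R <= _).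
      by rewrite -[1]/(1%:R) -natrD -!natrM ler_nat S2_le.
    by rewrite ler_wpM2r// log2_bound.
  + have ML0 : 0 <= M * ln n%:R ^+ 2 by apply: mulr_ge0 => //; exact: sqr_ge0.
    apply: ler_wpM2r; first exact: lower_bound_ge0.
    have -> : K1 * M * ln n%:R ^+ 2 = K1 * (M * ln n%:R ^+ 2) := esym (mulrA _ _ _).
    by apply: ler_wpM2r => //; rewrite lerDr ltW.
(* A natural number above the real ratio [c], as [S2_le_regular] works with natural numbers. *)
- move=> c; pose N := (Num.truncn c).+1.
  exists (K0 + N%:R ^+ 2); first by rewrite addr_gt0 ?exprn_gt0.
  move=> n n1 reg; have [Gn iso cov ind uni] := star n n1; split.
    apply: le_trans (lower_le_upper R Gn n1 iso cov ind uni) _.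
    by rewrite ler_wpM2r ?upper_bound_ge0// lerDl exprn_ge0.
  apply: le_trans (upper_le_lower Gn n1 iso cov ind uni (c := N%:R ^+ 2) _ _) _.
  + exact: sqr_ge0.
  + rewrite -natrX -natrM ler_nat; apply: (S2_le_regular ind) => u v uU vU.
    rewrite -(ler_nat R) natrM; apply: le_trans (reg u v uU vU) _.
    by rewrite ler_wpM2r// ltW// truncnS_gt.
  + rewrite ler_wpM2r ?lower_bound_ge0// ler_wpM2r ?sqr_ge0//.
    by rewrite lerDr ltW.
Qed.
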